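(* Let $P\in\mathbb{Z}[X]$ be permutative and let $\deg P>1$. There exists a Toeplitz word $x\in\{0,1\}^{\mathbb{Z}}$ such that the Toeplitz system $X_x$ is strictly ergodic, for each $y\in X_x$ the orbit $(\sigma^{P(n)}y)_{n\ge1}$ is dense in $X_x$, but the limit $$\lim_{N\to\infty}\frac{1}{N}\sum_{1\le m\leq N}G(\sigma^{P(m)}x)$$ does not exist for the continuous function $G:X_x\to\mathbb{C}$, $G(y)=(-1)^{y(0)}$.
   Context: Let $\sigma$ be the left shift on $\{0,1\}^{\mathbb{Z}}$ (product topology), $(\sigma y)(i)=y(i+1)$. A word $x\in\{0,1\}^{\mathbb{Z}}$ is called a Toeplitz word if for every $a\in\mathbb{Z}$ there exists $\ell\in\mathbb{Z}^+$ such that $x(a)=x(a+j\ell)$ for all $j\in\mathbb{Z}$. The Toeplitz system $X_x$ is the orbit closure $\overline{\{\sigma^n x:n\in\mathbb{Z}\}}$ in $\{0,1\}^{\mathbb{Z}}$ with the action of $\sigma$; it is minimal. Strictly ergodic means minimal with a unique $\sigma$-invariant Borel probability measure. A polynomial $P\in\mathbb{Z}[X]$ is a permutation modulo $n$ if the induced map $P:\mathbb{Z}/n\mathbb{Z}\to\mathbb{Z}/n\mathbb{Z}$ is a bijection. $P$ is permutative if it is a permutation modulo $n$ for infinitely many $n\in\mathbb{Z}^+$. *)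

(* Defs.v *)
From HB Require Import structures.
From mathcomp Require Import all_boot all_order all_algebra.
From mathcomp Require Import complex.
From mathcomp Require Import all_classical all_reals all_analysis.

Set Implicit Arguments.
Unset Strict Implicit.
Unset Printing Implicit Defensive.

Import Order.TTheory GRing.Theory Num.Theory.
Import numFieldNormedType.Exports.

Local Open Scope classical_set_scope.
Local Open Scope ring_scope.

(* Every polynomial is a permutation modulo 1; this case is separate because
   'Z_1 is the ring of integers modulo 2. *)
Definition permutation_mod (P : {poly int}) (n : nat) : Prop :=
  n = 1%N \/
  (1 < n)%N /\ bijective (fun a : 'Z_n => (map_poly intr P).[a]).

Definition permutative (P : {poly int}) : Prop :=
  infinite_set [set n | permutation_mod P n].

Section TopologicalDynamics.
Variables (T : ptopologicalType) (f : T -> T).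

Definition minimal : Prop :=
  forall F : set T, closed F -> F !=set0 -> f @` F = F -> F = setT.

Definition borel : measurableType _ := g_sigma_algebraType (@open T).

Definition invariant_measure (R : realType) (mu : probability borel R) : Prop :=
  forall A : set borel, measurable A -> mu (f @^-1` A) = mu A.

(* Measures are functions on all sets, constrained on measurable sets only. *)
Definition uniquely_ergodic (R : realType) : Prop :=
  exists2 mu : probability borel R, invariant_measure mu &
    forall nu : probability borel R, invariant_measure nu ->
      forall A : set borel, measurable A -> nu A = mu A.

Definition strictly_ergodic (R : realType) : Prop :=
  minimal /\ uniquely_ergodic R.

End TopologicalDynamics.

Notation word := {ptws int -> bool}.

Definition sigma (y : word) : word := fun i => y (i + 1).

(* [sigma_pow n] is the [n]-th power of the homeomorphism [sigma]. *)
Definition sigma_pow (n : int) (y : word) : word := fun i => y (i + n).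

Lemma sigma_pow0 y : sigma_pow 0 y = y.
Proof. by apply/funext => i; rewrite /sigma_pow addr0. Qed.

Lemma sigma_powD m n y : sigma_pow (m + n) y = sigma_pow m (sigma_pow n y).
Proof. by apply/funext => i; rewrite /sigma_pow addrA. Qed.

Lemma sigma_pow1 y : sigma_pow 1 y = sigma y.
Proof. by []. Qed.

Lemma continuous_sigma_pow n : continuous (sigma_pow n).
Proof.
move=> y; apply/cvg_sup => i A [B [[V oV <-] /= Vy] sBA].
apply: (filterS sBA).
exact: (@proj_continuous _ _ (i + n) y _ (open_nbhs_nbhs (conj oV Vy))).
Qed.

Definition toeplitz_word (x : word) : Prop :=
  forall a : int, exists2 l : int, 0 < l & forall j : int, x a = x (a + j * l).

Definition orbit_closure (x : word) : set word :=
  closure (range (fun n : int => sigma_pow n x)).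

Lemma orbit_closure_self x : x \in orbit_closure x.
Proof. by apply/mem_set/subset_closure; exists 0 => //; exact: sigma_pow0. Qed.

Lemma orbit_closure_sigma_pow x n y :
  y \in orbit_closure x -> sigma_pow n y \in orbit_closure x.
Proof.
move=> /set_mem cy; apply/mem_set => A /continuous_sigma_pow /cy[_ [[k _ <-] Ak]].
by exists (sigma_pow n (sigma_pow k x)); split=> //; exists (n + k) => //;
  exact: sigma_powD.
Qed.

Definition toeplitz_system (x : word) : Type := set_type (orbit_closure x).

Definition toeplitz_point (x : word) : toeplitz_system x :=
  exist _ x (orbit_closure_self x).

HB.instance Definition _ x := Topological.on (toeplitz_system x).
HB.instance Definition _ x :=
  isPointed.Build (toeplitz_system x) (toeplitz_point x).

Definition system_pow x (n : int) (y : toeplitz_system x) : toeplitz_system x :=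
  exist _ (sigma_pow n (val y)) (orbit_closure_sigma_pow n (valP y)).

(* The complex numbers over [R], with the topology of the modulus: the generic
   normed topology is attached to [numFieldType], not to [R[i]]. *)
Definition complex_field (R : realType) : numFieldType := R[i].
Arguments complex_field : simpl never.

Definition sign_at0 (R : realType) x (y : toeplitz_system x) : complex_field R :=
  (-1) ^+ (val y 0 : bool).

Lemma continuous_sign_at0 (R : realType) x : continuous (@sign_at0 R x).
Proof.
move=> y A A1.
have cv : continuous (val : toeplitz_system x -> word).
  exact: (@initial_continuous (orbit_closure x) word set_val).
apply: (cv y [set w : word | A ((-1) ^+ (w 0 : bool))]).
apply: (@proj_continuous _ (fun=> bool) 0 (val y) [set b : bool | A ((-1) ^+ b)]).
rewrite nbhs_principalE; apply/principal_filterP; exact: (@nbhs_singleton (complex_field R) _ _ A1).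
Qed.

(* Main.v *)
Require Import Defs.
From HB Require Import structures.
From mathcomp Require Import all_boot all_order all_algebra.
From mathcomp Require Import complex.
From mathcomp Require Import all_classical all_reals all_analysis.
From mathcomp Require Import measurable_realfun.
From mathcomp Require Import zify ring lra.

Set Implicit Arguments.
Unset Strict Implicit.
Unset Printing Implicit Defensive.

Import Order.TTheory GRing.Theory Num.Theory.
Import numFieldNormedType.Exports.

Local Open Scope classical_set_scope.
Local Open Scope ring_scope.

(* The word [x] is a limit of [n k]-periodic words, where [n 0 %| n 1 %| ...] is
   a fast growing chain of moduli that [P] permutes. At level [k] the values
   [P 1, ..., P (n k)], except the few lying near positions treated before, all
   get the letter [odd k], repeated with period [n k.+1]. As [P] is a
   permutation modulo [n k], the exceptions are rare, so the averages up to
   [n k] alternate in sign and stay away from 0. Since [deg P > 1], the values of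
   [P] have gaps tending to infinity, and the margins around the treated
   positions keep a window from meeting several high levels; hence the positions
   changed from level [k] on have small density in all long windows. So [x] is a
   Weyl limit of periodic words, visits to a cylinder have uniform frequencies,
   and these determine the invariant measure. *)

Implicit Types (f g : int -> bool) (a b c : int) (M N : nat).

(** * Weyl limits of periodic functions *)

(** The moduli meet two demands. Density of the orbits along [P], and with it minimality, needs
    every central window of [x] to repeat with a period modulo which [P] is onto: then some [P m]
    lies in any prescribed class and carries a given point of the system into a given cylinder.
    Divergence needs letters prescribed at values [P m] that range far beyond [n k]. The period
    [n k.+1] serves both, being good for [P] and much larger than these values. The margin of level
    [j] has density at most [2^-j / 8], so at most a quarter of the letters read up to time [n k]
    are wrong and the average there is at least [1/2] in modulus. Suitable chains exist because good
    moduli pass to divisors and coprime products: either the good primes are unbounded, or all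
    powers of a single prime are good. *)

Definition count_window (f : int -> bool) (a : int) (N : nat) : nat :=
  (\sum_(i < N) f (a + i%:Z)%R)%N.

Lemma count_windowD f a M N :
  count_window f a (M + N) = (count_window f a M + count_window f (a + M%:Z)%R N)%N.
Proof.
rewrite /count_window big_split_ord /=; congr addn.
by apply: eq_bigr => i _; rewrite PoszD addrA.
Qed.

Lemma count_windowS f a N :
  count_window f a N.+1 = (count_window f a N + f (a + N%:Z)%R)%N.
Proof. by rewrite /count_window big_ord_recr. Qed.

Lemma count_window_le f g a N :
  (forall b, a <= b < a + N%:Z -> f b -> g b) ->
  (count_window f a N <= count_window g a N)%N.
Proof.
move=> fg; apply: leq_sum => i _; case E: (f _) => //; rewrite fg//.
by have := ltn_ord i; lia.
Qed.

Lemma eq_count_window f g a N : f =1 g ->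
  count_window f a N = count_window g a N.
Proof. by move=> fg; apply: eq_bigr => i _; rewrite fg. Qed.

Lemma count_window_orb f g a N : (count_window (fun b => f b || g b) a N <=
  count_window f a N + count_window g a N)%N.
Proof.
by rewrite /count_window -big_split; apply: leq_sum => i _; case: (f _); case: (g _).
Qed.

Lemma count_window_size f a N : (count_window f a N <= N)%N.
Proof.
rewrite -[leqRHS]card_ord -sum1_card; apply: leq_sum => i _; exact: leq_b1.
Qed.

Lemma count_window_shift f c a N :
  count_window (fun b => f (b + c)) a N = count_window f (a + c) N.
Proof. by apply: eq_bigr => i _; rewrite addrAC. Qed.

Lemma count_window_seq f a N (s : seq int) :
  (forall b, a <= b < a + N%:Z -> f b -> b \in s) ->
  (count_window f a N <= size s)%N.
Proof.
move=> fs; rewrite /count_window -big_mkcond /= sum1_card cardE.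
rewrite -(size_map (fun i : 'I_N => a + i%:Z)); apply: uniq_leq_size.
  rewrite map_inj_uniq ?enum_uniq// => i j /addrI [] ij; exact: val_inj.
move=> _ /mapP[i + ->]; rewrite mem_enum => fi; apply: fs => //.
by have := ltn_ord i; lia.
Qed.

Section periodic.
Variables (g : int -> bool) (p : nat).
Hypothesis gp : forall b, g (b + p%:Z) = g b.

Lemma periodicM b (t : int) : g (b + t * p%:Z) = g b.
Proof.
have pos c (n : nat) : g (c + n%:Z * p%:Z) = g c.
  elim: n c => [|n IHn] c; first by rewrite mul0r addr0.
  by rewrite intS mulrDl mul1r addrA IHn gp.
case: t => n; first exact: pos.
by rewrite -(pos (b + _) n.+1) NegzE -addrA mulNr addNr addr0.
Qed.

Lemma count_window_period a b : count_window g a p = count_window g b p.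
Proof.
(* A window of length [p + 1] is split off at either end; the two extra letters agree by
   periodicity. *)
have step c : count_window g (c + 1) p = count_window g c p.
  have := count_windowS g c p; rewrite gp -add1n count_windowD.
  by rewrite /count_window big_ord_recl big_ord0 addn0 addr0 addnC => /addIn.
have pos c (n : nat) : count_window g (c + n%:Z) p = count_window g c p.
  elim: n => [|n IHn]; first by rewrite addr0.
  by rewrite -addn1 PoszD addrA step.
by case: (lerP a b) => [ab|/ltW ab]; [rewrite -[b](subrK a)|rewrite -[a](subrK b)];
  rewrite addrC -[_ - _]gez0_abs ?subr_ge0// pos.
Qed.

Lemma count_window_periodM a q :
  count_window g a (q * p) = (q * count_window g 0 p)%N.
Proof.
elim: q a => [|q IHq] a; first by rewrite /count_window big_ord0.
by rewrite mulSn count_windowD IHq (count_window_period _ 0).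
Qed.

Lemma count_window_periodic_le a b N : (0 < p)%N ->
  (count_window g a N <= count_window g b N + p)%N.
Proof.
move=> p0; rewrite (divn_eq N p) !count_windowD !count_window_periodM.
rewrite -addnA leq_add2l (leq_trans _ (leq_addl _ _))//.
exact: leq_trans (count_window_size _ _ _) (ltnW (ltn_pmod _ p0)).
Qed.

Lemma count_window_periodic_ub a N : (0 < p)%N ->
  (count_window g a N <= (N %/ p).+1 * count_window g 0 p)%N.
Proof.
move=> p0; rewrite -(count_window_periodM a) mulSn addnC.
rewrite [in leqLHS](divn_eq N p) !count_windowD leq_add2l.
rewrite -[X in (_ <= count_window _ _ X)%N](subnKC (ltnW (ltn_pmod N p0))) count_windowD.
exact: leq_addr.
Qed.

End periodic.

(** The closure of the periodic sets in the Weyl pseudometric (upper Banach density of the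
    difference), with tolerance [1/e] and all counting kept in [nat]. *)
Definition weyl_periodic (f : int -> bool) : Prop :=
  forall e : nat, exists (g : int -> bool) (p N0 : nat),
    [/\ (0 < p)%N, forall b, g (b + p%:Z) = g b &
      forall N a, (N0 <= N)%N -> (e * count_window (fun b => f b (+) g b) a N <= N)%N].

Lemma weyl_periodic_ext f g : f =1 g -> weyl_periodic f -> weyl_periodic g.
Proof. by move=> /funext ->. Qed.

Lemma weyl_periodic_cst (b : bool) : weyl_periodic (fun=> b).
Proof.
move=> e; exists (fun=> b), 1%N, 0%N; split=> // N a _.
by rewrite /count_window big1 ?muln0// => i _; rewrite addbb.
Qed.

Lemma weyl_periodicN f : weyl_periodic f -> weyl_periodic (fun b => ~~ f b).
Proof.
move=> wf e; have [g [p [N0 [p0 gp h]]]] := wf e.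
exists (fun b => ~~ g b), p, N0; split=> // [b|N a NN0]; first by rewrite gp.
by under eq_count_window do rewrite addbN addNb negbK; exact: h.
Qed.

(** With complements this gives a Boolean algebra, from which the algebra of sets carrying the
    invariant measure is built. *)
Lemma weyl_periodicI f f' : weyl_periodic f -> weyl_periodic f' ->
  weyl_periodic (fun b => f b && f' b).
Proof.
move=> wf wf' e.
have [g [p [N0 [p0 gp h]]]] := wf (e * 2)%N.
have [g' [p' [N0' [p0' gp' h']]]] := wf' (e * 2)%N.
exists (fun b => g b && g' b), (p * p')%N, (maxn N0 N0'); split.
- by rewrite muln_gt0 p0.
- by move=> b; rewrite PoszM (periodicM gp') mulrC (periodicM gp).
- move=> N a; rewrite geq_max => /andP[/(h _ a) + /(h' _ a)].
  have := count_window_orb (fun b => f b (+) g b) (fun b => f' b (+) g' b) a N.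
  have : (count_window (fun b => f b && f' b (+) (g b && g' b)) a N <=
      count_window (fun b => (f b (+) g b) || (f' b (+) g' b)) a N)%N.
    by apply: count_window_le => b _; case: (f b); case: (f' b); case: (g b); case: (g' b).
  nia.
Qed.

Lemma weyl_periodicU f f' : weyl_periodic f -> weyl_periodic f' ->
  weyl_periodic (fun b => f b || f' b).
Proof.
move=> /weyl_periodicN wf /weyl_periodicN wf'.
apply: weyl_periodic_ext (weyl_periodicN (weyl_periodicI wf wf')) => b.
by rewrite negb_and !negbK.
Qed.

Lemma weyl_periodic_shift f c : weyl_periodic f ->
  weyl_periodic (fun b => f (b + c)).
Proof.
move=> wf e; have [g [p [N0 [p0 gp h]]]] := wf e.
exists (fun b => g (b + c)), p, N0; split=> // [b|N a NN0].
  by rewrite addrAC gp.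
by rewrite (count_window_shift (fun b => f b (+) g b)); exact: h.
Qed.

Lemma weyl_periodic_uniform f : weyl_periodic f -> forall e : nat,
  exists N0, forall N a b, (N0 <= N)%N ->
    (e * count_window f a N <= e * count_window f b N + N)%N.
Proof.
move=> wf e; have [g [p [N0 [p0 gp h]]]] := wf (4 * e)%N.
(* Passing from [f] to [g] and back costs [N / (4 * e)] each time; moving the window of [g] costs
   [p <= N / (2 * e)]. *)
exists (maxn N0 (2 * e * p)) => N a b; rewrite geq_max => /andP[NN0].
have := h N a NN0; have := h N b NN0.
have := count_window_periodic_le gp a b N p0.
have d1 c : (count_window f c N <=
    count_window g c N + count_window (fun b => f b (+) g b) c N)%N.
  apply: leq_trans (count_window_orb _ _ _ _).
  by apply: count_window_le => i _; case: (f i); case: (g i).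
have d2 c : (count_window g c N <=
    count_window f c N + count_window (fun b => f b (+) g b) c N)%N.
  apply: leq_trans (count_window_orb _ _ _ _).
  by apply: count_window_le => i _; case: (f i); case: (g i).
have := d1 a; have := d2 b; nia.
Qed.

(** * Polynomials modulo n and gaps between their values *)

(** Stated with integers, so that passing to divisors and to coprime products needs no maps between
    residue rings and the modulus 1 is no special case. *)
Definition surjective_mod (P : {poly int}) (n : nat) : Prop :=
  (0 < n)%N /\ forall b : int, exists a : int, (n%:Z %| P.[a] - b)%Z.

Lemma dvdz_horner (P : {poly int}) (n : nat) (a b : int) :
  (n%:Z %| a - b)%Z -> (n%:Z %| P.[a] - P.[b])%Z.
Proof.
have /factor_theorem[q PE] : root (P - P.[b]%:P) b.
  by rewrite /root hornerD hornerN hornerC subrr.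
have -> : P.[a] - P.[b] = (P - P.[b]%:P).[a] by rewrite hornerD hornerN hornerC.
by rewrite PE hornerM hornerXsubC; exact: dvdz_mull.
Qed.

Lemma surjective_mod_nat (P : {poly int}) (n : nat) (b : int) :
  surjective_mod P n ->
  exists2 m : nat, (0 < m <= n)%N & (n%:Z %| P.[m%:Z] - b)%Z.
Proof.
move=> [n0 /(_ b)[a nab]].
(* Reducing [a - 1] instead of [a] gives a representative in [1..n], the range of the averages. *)
have [k [r [kr rn]]] : exists k r : int, a - 1 = k * n%:Z + r /\ 0 <= r < n%:Z.
  exists ((a - 1) %/ n%:Z)%Z, ((a - 1) %% n%:Z)%Z; split; first exact: divz_eq.
  by rewrite modz_ge0 ?ltz_mod//; lia.
exists `|r|.+1; first by lia.
have -> : P.[`|r|.+1%:Z] - b = (P.[`|r|.+1%:Z] - P.[a]) + (P.[a] - b).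
  by rewrite addrA subrK.
apply: rpredD => //; apply: dvdz_horner; apply/dvdzP; exists (- k); lia.
Qed.

Lemma intr_Zp_eq0 (n : nat) (z : int) : (1 < n)%N ->
  z%:~R = 0 :> 'Z_n -> (n%:Z %| z)%Z.
Proof.
move=> n1.
have nat_eq0 (m : nat) : m%:R = 0 :> 'Z_n -> (n %| m)%N.
  by move=> /(congr1 (@nat_of_ord _)); rewrite val_Zp_nat// => /eqP.
case: z => m; rewrite dvdzE.
  by rewrite -pmulrn; exact: nat_eq0.
rewrite NegzE rmorphN /= => /eqP; rewrite oppr_eq0 => /eqP; exact: nat_eq0.
Qed.

Lemma permutation_mod_surjective (P : {poly int}) (n : nat) :
  permutation_mod P n -> surjective_mod P n.
Proof.
move=> [->|[n1 [g gK Kg]]]; first by split=> // b; exists 0; rewrite dvd1z.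
split=> [|b]; first exact: ltnW.
pose a := (nat_of_ord (g b%:~R))%:Z; exists a; apply: intr_Zp_eq0 => //.
have := Kg b%:~R; rewrite -[g _]natr_Zp pmulrn (horner_map intr) => Pab.
by rewrite rmorphB; apply/eqP; rewrite subr_eq0; exact/eqP.
Qed.

Lemma surjective_mod_dvd (P : {poly int}) (d n : nat) : (d %| n)%N ->
  surjective_mod P n -> surjective_mod P d.
Proof.
move=> dn [n0 sn]; split; first exact: dvdn_gt0 dn.
move=> b; have [a na] := sn b; exists a; apply: dvdz_trans na.
by rewrite dvdzE.
Qed.

Lemma surjective_modM (P : {poly int}) (m n : nat) : coprime m n ->
  surjective_mod P m -> surjective_mod P n -> surjective_mod P (m * n).
Proof.
move=> mn [m0 sm] [n0 sn]; split; first by rewrite muln_gt0 m0.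
move=> b; have [a ma] := sm b; have [c nc] := sn b.
have cop : coprimez m%:Z n%:Z by [].
exists (zchinese m n a c).
rewrite PoszM Gauss_dvdz//; apply/andP; split.
- rewrite -(subrK P.[a] (P.[_])) -addrA; apply: rpredD => //.
  by apply: dvdz_horner; rewrite -eqz_mod_dvd zchinese_modl.
- rewrite -(subrK P.[c] (P.[_])) -addrA; apply: rpredD => //.
  by apply: dvdz_horner; rewrite -eqz_mod_dvd zchinese_modr.
Qed.

(* If only primes below [B] are good moduli, some prime has arbitrarily high
   good powers, since otherwise the good moduli divide a fixed number. *)
Lemma unbounded_prime_power (P : {poly int}) (B : nat) :
  infinite_set [set n | surjective_mod P n] ->
  (forall p, prime p -> surjective_mod P p -> (p < B)%N) ->
  exists2 p, prime p & forall e, surjective_mod P (p ^ e).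
Proof.
move=> infP boundP; apply: contrapT => no.
have /choice[e eP] (p : nat) : exists e : nat,
    prime p -> ~ surjective_mod P (p ^ e).
  have [pp|_] := boolP (prime p); last by exists 0%N.
  apply: contrapT => noe; apply: no; exists p => // e.
  by apply: contrapT => npe; apply: noe; exists e.
(* The [maxn] keeps the factor at [p = 0] from vanishing. *)
pose M := (\prod_(p < B) (maxn p 1) ^ e p)%N.
have M0 : (0 < M)%N.
  by rewrite prodn_gt0// => p; rewrite expn_gt0 leq_max orbT.
apply: infP; apply: (@sub_finite_set _ _ `I_M.+1); last exact: finite_II.
move=> n /= sn; rewrite ltnS; apply: dvdn_leq => //.
have n0 := sn.1; apply/dvdn_partP => // p pn.
have pp : prime p by move: pn; rewrite mem_primes => /andP[].
have pdn : (p %| n)%N by move: pn; rewrite mem_primes => /and3P[].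
have pB : (p < B)%N by apply: boundP => //; exact: surjective_mod_dvd sn.
rewrite p_part /M (bigD1 (Ordinal pB))//=; apply: dvdn_mulr.
rewrite (maxn_idPl (prime_gt0 pp)).
have [ge|/ltnW] := leqP (e p) (logn p n); last exact: dvdn_exp2l.
exfalso; apply: (eP p pp); apply: surjective_mod_dvd sn.
by apply: dvdn_trans (pfactor_dvdnn p n); exact: dvdn_exp2l.
Qed.

(** If the good primes are unbounded, [C] is the class of all good moduli and a large good prime,
    coprime to [n], is multiplied in. Otherwise good moduli need not be coprime, and [C] is
    restricted to the powers of one prime. *)
Lemma surjective_mod_chain (P : {poly int}) : permutative P ->
  exists C : nat -> Prop,
    [/\ C 1%N, forall n, C n -> surjective_mod P n &
      forall n B, C n -> exists n', [/\ C n', (n %| n')%N & (B <= n')%N]].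
Proof.
move=> Pperm.
have infP : infinite_set [set n | surjective_mod P n].
  move=> fin; apply: Pperm; apply: sub_finite_set fin => n.
  exact: permutation_mod_surjective.
have s1 : surjective_mod P 1 by split=> // b; exists 0; rewrite dvd1z.
have [[B boundP]|unb] := pselect (exists B, forall p, prime p ->
    surjective_mod P p -> (p < B)%N).
- have [p pp pe] := unbounded_prime_power infP boundP.
  exists (fun n => exists e, n = p ^ e)%N; split.
  + by exists 0%N.
  + by move=> n [e ->].
  + move=> _ B' [e ->]; exists (p ^ (e + B'))%N; split; first by exists (e + B')%N.
      by apply: dvdn_exp2l; exact: leq_addr.
    apply: (leq_trans (ltnW (ltn_expl B' (prime_gt1 pp)))).
    by rewrite leq_exp2l ?prime_gt1// leq_addl.
- exists (surjective_mod P); split=> // n B sn.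
  have [p [pp sp np]] : exists p, [/\ prime p, surjective_mod P p & (maxn n.+1 B <= p)%N].
    apply: contrapT => no; apply: unb; exists (maxn n.+1 B) => p pp sp.
    by rewrite ltnNge; apply/negP => le; apply: no; exists p.
  move: np; rewrite geq_max => /andP[np Bp].
  exists (n * p)%N; split.
  + apply: surjective_modM => //; rewrite coprime_sym prime_coprime//.
    by apply/negP => /(dvdn_leq sn.1); rewrite leqNgt np.
  + exact: dvdn_mulr.
  + by apply: leq_trans Bp _; exact: leq_pmull sn.1.
Qed.

(* For [P = q * 'X + c] the increment of [P] at [m] is
   [m * (q (m + 1) - q m) + q (m + 1)], so growth passes from [q] to [P]. *)
Lemma poly_eventually_increasing (P : {poly int}) : (1 < size P)%N ->
  exists (s : int) (m0 : nat), `|s| = 1 /\ forall m : nat, (m0 <= m)%N ->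
    1 <= s * P.[m%:Z] /\ 1 <= s * (P.[m%:Z + 1] - P.[m%:Z]).
Proof.
elim/poly_ind: P => [|q c IHq]; first by rewrite size_poly0.
have hE (x : int) : (q * 'X + c%:P).[x] = q.[x] * x + c.
  by rewrite hornerD hornerM hornerX hornerC.
have [q1|q1] := leqP (size q) 1.
  have [d qE] : exists d, q = d%:P by exists q`_0; exact: size1_polyC.
  rewrite qE => sP; have d0 : d != 0.
    apply: contraL sP => /eqP ->; rewrite mul0r add0r -leqNgt.
    exact: size_polyC_leq1.
  exists (if 0 < d then 1 else -1), `|c|.+1; split; first by case: ifP.
  move=> m cm; rewrite -!qE !hE !qE !hornerC; case: ifP => [dp|/negbT dn].
    by have := @ler_peMl _ d m%:Z isT dp; split; lia.
  have dn' : 1 <= - d by lia.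
  by have := @ler_peMl _ (- d) m%:Z isT dn'; split; lia.
move=> _; have [s [m0 [s1 h]]] := IHq q1.
exists s, (maxn m0 `|c|.+1); split=> // m; rewrite geq_max => /andP[m0m cm].
have [h1 h2] := h m m0m; have [h3 _] := h m.+1 (leqW m0m).
rewrite !hE; move: h3; rewrite -addn1 PoszD => h3.
have sc : - `|c|%:Z <= s * c.
  by have [->|->] : s = 1 \/ s = -1; lia.
split; first by nia.
have := ler_peMr (isT : 0 <= m%:Z) h2; nia.
Qed.

(** Degree above one makes [q] nonconstant in [P = q * 'X + c]. The increments of [P] then
    eventually have one sign and size at least [m], so they add up without cancellation. *)
Lemma poly_gap (P : {poly int}) (G : nat) : (1 < (size P).-1)%N ->
  exists m0 : nat, forall m i : nat, (m0 <= m)%N ->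
    ((i * G)%N%:Z <= `|P.[m%:Z + i%:Z] - P.[m%:Z]|).
Proof.
elim/poly_ind: P => [|q c _]; first by rewrite size_poly0.
move=> sP; have sq : (1 < size q)%N.
  by move: sP; rewrite size_MXaddC; case: ifP => // _; lia.
have hE (x : int) : (q * 'X + c%:P).[x] = q.[x] * x + c.
  by rewrite hornerD hornerM hornerX hornerC.
have [s [m0 [s1 h]]] := poly_eventually_increasing sq.
exists (maxn m0 G) => m i; rewrite geq_max => /andP[m0m Gm].
suff : (i * G)%N%:Z <= s * ((q * 'X + c%:P).[m%:Z + i%:Z] - (q * 'X + c%:P).[m%:Z]).
  move=> /le_trans; apply; rewrite -[leRHS]mul1r -s1 -normrM; exact: ler_norm.
elim: i => [|i IHi]; first by rewrite addr0 subrr mulr0.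
have [h1 h2] := h (m + i)%N (leq_trans m0m (leq_addr _ _)).
have [h3 _] := h (m + i).+1 (leqW (leq_trans m0m (leq_addr _ _))).
have e1 : (m + i)%N%:Z = m%:Z + i%:Z by lia.
have e2 : (m + i).+1%:Z = m%:Z + i%:Z + 1 by lia.
have e3 : m%:Z + i.+1%:Z = m%:Z + i%:Z + 1 by lia.
move: IHi h1 h2 h3; rewrite !hE e1 e2 e3 => IHi _ h2 h3.
have := ler_peMr (isT : 0 <= m%:Z + i%:Z) h2; lia.
Qed.

Definition poly_range (P : {poly int}) (b : int) : bool :=
  `[< exists m : nat, b = P.[m%:Z] >].

Lemma poly_range_sparse (P : {poly int}) (e : nat) : (1 < (size P).-1)%N ->
  exists L0, forall L a, (L0 <= L)%N ->
    (e * count_window (poly_range P) a L <= L)%N.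
Proof.
move=> sP; have [m0 gap] := poly_gap (e * 2).+1 sP.
(* [L0] absorbs the [m0 + 1] exceptional values in one half of [L]; the gap [G = 2 * e + 1] keeps
   the remaining values within the other half. *)
exists (e * 2 * m0.+1)%N => L a L0L; set G := (e * 2).+1 in gap *.
suff : (count_window (poly_range P) a L <= m0 + (L %/ G).+1)%N.
  by have := leq_trunc_div L G; rewrite /G; nia.
pose inw m := (m0 <= m)%N && (a <= P.[m%:Z] < a + L%:Z).
have init b m : b = P.[m%:Z] -> (m < m0)%N ->
    b \in [seq P.[m%:Z] | m <- iota 0 m0].
  by move=> -> mm0; apply: map_f; rewrite mem_iota.
have [[m1' inw1]|noin] := pselect (exists m, inw m); last first.
  apply: leq_trans (leq_addr _ _); rewrite -[leqRHS](size_iota 0).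
  rewrite -(size_map (fun m : nat => P.[m%:Z])); apply: count_window_seq.
  move=> b bw /asboolP[m bm]; apply: (init _ m) => //; rewrite ltnNge.
  by apply/negP => m0m; apply: noin; exists m; rewrite /inw m0m -bm.
have exm : exists m, inw m by exists m1'.
have [m1 /andP[m01 w1] min1] := ex_minnP exm.
pose s := [seq P.[m%:Z] | m <- iota 0 m0] ++
          [seq P.[m1%:Z + i%:Z] | i <- iota 0 (L %/ G).+1].
have -> : (m0 + (L %/ G).+1)%N = size s by rewrite size_cat !size_map !size_iota.
apply: count_window_seq => b bw /asboolP[m bm]; rewrite mem_cat.
have [/(init _ _ bm) ->//|m0m] := ltnP m m0.
have mm1 : (m1 <= m)%N by apply: min1; rewrite /inw m0m -bm.
apply/orP; right; apply/mapP; exists (m - m1)%N; last by rewrite bm; congr horner; lia.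
rewrite mem_iota /= add0n ltnS leq_divRL//.
have := gap m1 (m - m1)%N m01.
have -> : m1%:Z + (m - m1)%N%:Z = m%:Z by lia.
by rewrite -bm; lia.
Qed.

(** Choosing an argument for each residue is injective, hence a permutation of the [n] indices; this
    recovers bijectivity from surjectivity. *)
Lemma sum_surjective_mod (P : {poly int}) (n : nat) f : surjective_mod P n ->
  (forall b, f (b + n%:Z) = f b) ->
  (\sum_(1 <= m < n.+1) f P.[m%:Z] = count_window f 0 n)%N.
Proof.
move=> sn fn; rewrite big_add1 big_mkord /count_window.
have /choice[g gP] (i : 'I_n) :
    exists j : 'I_n, (n%:Z %| P.[j.+1%:Z] - i%:Z)%Z.
  have [[//|m] /= mn nm] := surjective_mod_nat i%:Z sn.
  by exists (Ordinal mn).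
have g_inj : injective g.
  move=> i j gij; apply: val_inj => /=.
  have := rpredB (gP i) (gP j); rewrite gij => /dvdzP.
  case=> t tE; have jit : j%:Z - i%:Z = t * n%:Z by lia.
  have ltn := ltn_ord i; have ltj := ltn_ord j.
  have t0 : t = 0 by case: (ltrgt0P t) => // ?; nia.
  by move: jit; rewrite t0; lia.
rewrite (reindex_inj g_inj); apply: eq_bigr => i _; rewrite add0r.
have /dvdzP[t tE] := gP i.
by rewrite -(periodicM fn i t) -tE addrC subrK.
Qed.

(** Comparison with a geometric series, free of division; it adds up the densities of the margins of
    successive levels. *)
Lemma dyadic_sum_le (c : nat -> nat) (N K d : nat) :
  (forall j, (K <= j < K + d)%N -> (2 ^ j * c j <= N)%N) ->
  (2 ^ K * \sum_(K <= j < K + d) c j <= 2 * N)%N.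
Proof.
elim: d K => [|d IHd] K cN; first by rewrite addn0 big_geq// muln0.
rewrite big_ltn; last by lia.
have cK := cN K; have := IHd K.+1; rewrite addSnnS expnS => IH.
have {}IH := IH _; suff : (2 * 2 ^ K * \sum_(K.+1 <= i < K + d.+1) c i <= 2 * N)%N.
  by have := cK _; lia.
by apply: IH => j jK; apply: cN; lia.
Qed.

Lemma leq_sum_nat (m n : nat) (F G : nat -> nat) :
  (forall i, (m <= i < n)%N -> (F i <= G i)%N) ->
  (\sum_(m <= i < n) F i <= \sum_(m <= i < n) G i)%N.
Proof.
move=> FG; rewrite big_seq [leqRHS]big_seq; apply: leq_sum => i.
by rewrite mem_index_iota; exact: FG.
Qed.

(** * Construction of the word *)

Section construction.
Variables (P : {poly int}) (n E : nat -> nat).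
Hypothesis n_surj : forall k, surjective_mod P (n k).
Hypothesis n_dvd : forall k, (n k %| n k.+1)%N.
Hypothesis E_big : forall k m, (0 < m <= n k)%N -> (`|P.[m%:Z]| + n k <= E k)%N.
(** A margin of level [k] has [2 * E k + 1] elements per period [n k.+1], hence density at most
    [2^-k / 8]; over all levels this sums to at most [1/4]. *)
Hypothesis n_big : forall k, (2 ^ k * (8 * (2 * E k + 1)) <= n k.+1)%N.

Let n_gt0 k : (0 < n k)%N := (n_surj k).1.

Lemma period_dvd j k : (j <= k)%N -> (n j %| n k)%N.
Proof.
elim: k => [|k IHk]; first by rewrite leqn0 => /eqP ->.
by rewrite leq_eqVlt => /predU1P[->//|/IHk/dvdn_trans]; exact.
Qed.

Lemma period_le j k : (j <= k)%N -> (n j <= n k)%N.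
Proof. by move=> jk; apply: dvdn_leq => //; exact: period_dvd. Qed.

Lemma margin_ge k : (n k <= E k)%N.
Proof. by apply: leq_trans (E_big (m := 1%N) _); [exact: leq_addl | rewrite n_gt0]. Qed.

Lemma period_ge k : (k <= n k)%N.
Proof.
case: k => // k; apply: leq_trans (n_big k).
by have := ltn_expl k (ltnSn 1); nia.
Qed.

Lemma margin_period k : (8 * (2 * E k + 1) <= n k.+1)%N.
Proof. by apply: leq_trans (n_big k); rewrite leq_pmull// expn_gt0. Qed.

(* At level [k] the word is set to [odd k] at the values [P m], [1 <= m <= n k],
   that lie outside the margins of all earlier levels, and at their translates
   by [n k.+1]; these are the new positions. The margin of level [k] contains
   them together with everything at distance at most [n k]. *)
Definition near_multiple k (b : int) : bool :=
  `[< exists t : int, `|b - t * (n k.+1)%:Z| <= (E k)%:Z >].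

Definition new_position k (b : int) : bool :=
  `[< exists m : nat, [/\ (0 < m <= n k)%N,
      forall j, (j < k)%N -> ~~ near_multiple j P.[m%:Z] &
      ((n k.+1)%:Z %| b - P.[m%:Z])%Z] >].

Definition toeplitz_example : int -> bool := fun b =>
  `[< exists2 k, new_position k b & odd k >].

Lemma near_multipleD j k b (t : int) : (j < k)%N ->
  near_multiple j (b + t * (n k)%:Z) = near_multiple j b.
Proof.
move=> jk; apply: (periodicM (p := n k)) => {t}b.
have /dvdnP[q ->] := period_dvd jk.
rewrite PoszM; apply: (periodicM (p := n j.+1)) => {}b.
apply/asboolP/asboolP => -[t tE]; [exists (t - 1)|exists (t + 1)];
  by apply: le_trans tE; rewrite le_eqVlt; apply/orP; left; apply/eqP; congr `|_|; lia.
Qed.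

Lemma new_position_near k b : new_position k b -> near_multiple k b.
Proof.
move=> /asboolP[m [mn _ /dvdzP[t tE]]]; apply/asboolP; exists t.
by have := E_big mn; lia.
Qed.

(** The definition excludes earlier margins at [P m] only, but these margins have period [n k.+1],
    so the translates avoid them too. *)
Lemma new_position_far j k b : (j < k)%N -> new_position k b -> ~~ near_multiple j b.
Proof.
move=> jk /asboolP[m [_ far /dvdzP[t tE]]].
have -> : b = P.[m%:Z] + t * (n k.+1)%:Z by lia.
by rewrite near_multipleD ?far// ltnS ltnW.
Qed.

(** A new position lies in the margin of its own level, which all higher levels avoid. Hence no
    position receives two letters. *)
Lemma new_position_uniq j k b : new_position j b -> new_position k b -> j = k.
Proof.
by move=> pj pk; case: (ltngtP j k) => // lt;
  [have := new_position_far lt pk|have := new_position_far lt pj];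
  rewrite new_position_near.
Qed.

Lemma new_positionD j k b (t : int) : (j < k)%N ->
  new_position j (b + t * (n k)%:Z) = new_position j b.
Proof.
move=> jk; apply: (periodicM (p := n k)) => {t}b.
have jkd : ((n j.+1)%:Z %| (n k)%:Z)%Z by rewrite dvdzE; exact: period_dvd.
apply/asboolP/asboolP => -[m [mn far d]]; exists m; split=> //.
- have -> : b - P.[m%:Z] = b + (n k)%:Z - P.[m%:Z] - (n k)%:Z by lia.
  exact: rpredB.
- by rewrite addrAC; exact: rpredD.
Qed.

Lemma toeplitz_exampleE k b : new_position k b -> toeplitz_example b = odd k.
Proof.
move=> pk; apply/asboolP/idP => [[j pj]|ok]; last by exists k.
by rewrite (new_position_uniq pk pj).
Qed.

(** No level above [K] touches the margin of [K], and the levels up to [K] have period [n K.+1]. *)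
Lemma toeplitz_example_period K b (t : int) : near_multiple K b ->
  toeplitz_example (b + t * (n K.+1)%:Z) = toeplitz_example b.
Proof.
move=> Kb; apply/asboolP/asboolP => -[k pk ok]; exists k => //.
- rewrite -(new_positionD _ t (_ : k < K.+1)%N)// ltnS leqNgt.
  by apply/negP => Kk; have := new_position_far Kk pk; rewrite near_multipleD// Kb.
- rewrite (new_positionD _ t (_ : k < K.+1)%N)// ltnS leqNgt.
  by apply/negP => Kk; have := new_position_far Kk pk; rewrite Kb.
Qed.

Lemma near_multiple0 K b : `|b| <= (E K)%:Z -> near_multiple K b.
Proof. by move=> bE; apply/asboolP; exists 0; rewrite mul0r subr0. Qed.

Lemma toeplitz_example_window (r : nat) : exists2 l : nat, surjective_mod P l &
  forall b (t : int), `|b| <= r%:Z ->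
    toeplitz_example (b + t * l%:Z) = toeplitz_example b.
Proof.
exists (n r.+1) => // b t br; apply: toeplitz_example_period; apply: near_multiple0.
by apply: (le_trans br); rewrite lez_nat (leq_trans (period_ge r) (margin_ge r)).
Qed.

Lemma count_near_multiple k :
  (count_window (near_multiple k) 0 (n k.+1) <= 2 * E k + 1)%N.
Proof.
have pk b : near_multiple k (b + (n k.+1)%:Z) = near_multiple k b.
  by have := near_multipleD b 1 (ltnSn k); rewrite mul1r.
(* A period starting at [- E k] meets only the margin around 0. *)
rewrite (count_window_period pk 0 (- (E k)%:Z)).
rewrite -[leqRHS](size_iota 0) -(size_map (fun i : nat => i%:Z - (E k)%:Z)).
apply: count_window_seq => b bw /asboolP[t tE].
have bE : `|b| <= (E k)%:Z.
  have := margin_period k; case: (ltrgt0P t) tE => [t0|t0|->]; last by rewrite mul0r subr0.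
  - by have := @ler_peMl _ t (n k.+1)%:Z isT t0; lia.
  - have t0' : 1 <= - t by lia.
    by have := @ler_peMl _ (- t) (n k.+1)%:Z isT t0'; lia.
apply/mapP; exists `|(b + (E k)%:Z)%R|%N; last by lia.
by rewrite mem_iota; lia.
Qed.

(* [P] permutes the residues modulo [n k], so the proportion of [m <= n k] with
   [P m] in an earlier margin is the density of these margins. *)
Lemma wrong_value_count k :
  (4 * \sum_(1 <= m < (n k).+1) (toeplitz_example P.[m%:Z] != odd k) <= n k)%N.
Proof.
suff : (\sum_(1 <= m < (n k).+1) (toeplitz_example P.[m%:Z] != odd k) <=
    \sum_(0 <= j < 0 + k) count_window (near_multiple j) 0 (n k))%N.
  have c j : (0 <= j < 0 + k)%N ->
      (2 ^ j * (8 * count_window (near_multiple j) 0 (n k)) <= n k)%N.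
    rewrite add0n => /= jk; have /dvdnP[q nq] := period_dvd jk.
    have pj b : near_multiple j (b + (n j.+1)%:Z) = near_multiple j b.
      by have := near_multipleD b 1 (ltnSn j); rewrite mul1r.
    rewrite nq (count_window_periodM pj).
    rewrite (mulnCA 8) (mulnCA (2 ^ j)%N) leq_mul2l; apply/orP; right.
    apply: leq_trans (n_big j); rewrite !leq_mul2l count_near_multiple.
    by rewrite !orbT.
  (* From level 0 on, eight times the sum is at most [2 * n k]. *)
  have := dyadic_sum_le c; rewrite -big_distrr /=; lia.
rewrite add0n.
have step (m : nat) : (1 <= m < (n k).+1)%N ->
    ((toeplitz_example P.[m%:Z] != odd k) <=
     \sum_(0 <= j < k) near_multiple j P.[m%:Z])%N.
  (* If [P m] avoids all earlier margins, it is itself a new position of level [k]. *)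
  move=> mn; case: (boolP (_ != _)) => // wrong; rewrite lt0n.
  apply: contra wrong; rewrite sum_nat_seq_eq0 => /allP far.
  apply/eqP; apply: toeplitz_exampleE; apply/asboolP; exists m; split=> //.
    by move=> j jk; have := far j; rewrite mem_index_iota jk /= eqb0; exact.
  by rewrite subrr dvdz0.
rewrite (leq_trans (leq_sum_nat step))//.
rewrite exchange_big /=; apply: leq_sum_nat => j /= jk.
rewrite (sum_surjective_mod (n_surj k))// => b.
by have := near_multipleD b 1 jk; rewrite mul1r.
Qed.

(** A window no longer than [n j.+1] meets at most two translates of the margin; moving each back to
    the origin leaves plain values of [P]. *)
Lemma new_position_sparse j N a : (N <= n j.+1)%N -> exists a1 a2,
  (count_window (new_position j) a N <=
   count_window (poly_range P) a1 N + count_window (poly_range P) a2 N)%N.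
Proof.
move=> Nn; set l := (n j.+1)%:Z.
have l0 : 0 < l by rewrite /l; have := n_gt0 j.+1; lia.
(* The least [t] with [a <= t * l + E j], that is, the first margin not entirely to the left of the
   window. *)
pose t1 := ((a - (E j)%:Z - 1) %/ l)%Z + 1.
have [lo hi] : (t1 - 1) * l <= a - (E j)%:Z - 1 /\ a - (E j)%:Z - 1 < t1 * l.
  rewrite /t1 addrK; split; first exact: lez_floor (lt0r_neq0 l0).
  exact: ltz_ceil.
exists (a - t1 * l), (a - (t1 + 1) * l).
rewrite -!count_window_shift; apply: leq_trans (count_window_orb _ _ _ _).
apply: count_window_le => b bw /asboolP[m [mn _ /dvdzP[t tE]]].
have mE := E_big mn; have nE := margin_period j.
have tt1 : t = t1 \/ t = t1 + 1.
  have : (t1 - 1) * l < t * l by rewrite /l in lo hi *; lia.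
  have : t * l < (t1 + 2) * l by rewrite /l in lo hi *; lia.
  by rewrite !ltr_pM2r//; lia.
by apply/orP; case: tt1 => tt1; [left|right]; apply/asboolP; exists m;
  rewrite -tt1 /l; lia.
Qed.

(* The margin of the lowest level that meets a short window covers the window,
   so no higher level has a new position there. *)
Lemma new_position_one_level k N a : (N <= n k)%N ->
  exists2 j, (k <= j)%N & forall b, a <= b < a + N%:Z ->
    `[< exists2 i, (k <= i)%N & new_position i b >] -> new_position j b.
Proof.
move=> Nk.
pose hit i := (k <= i)%N && `[< exists2 b, a <= b < a + N%:Z & new_position i b >].
have [[i0 hit0]|nohit] := pselect (exists i, hit i); last first.
  exists k => // b bw /asboolP[i ki pib]; exfalso; apply: nohit; exists i.
  by rewrite /hit ki; apply/asboolP; exists b.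
have exh : exists i, hit i by exists i0.
have [j /andP[kj /asboolP[b0 b0w pj]] jmin] := ex_minnP exh.
exists j => // b bw /asboolP[i ki pib].
have : (j <= i)%N by apply: jmin; rewrite /hit ki; apply/asboolP; exists b.
rewrite leq_eqVlt => /predU1P[->//|/new_position_far/(_ pib)/negP[]].
have /asboolP[m [mn _ /dvdzP[t tE]]] := pj.
apply/asboolP; exists t; have := E_big mn; have := period_le kj; lia.
Qed.

Hypothesis degP : (1 < (size P).-1)%N.

(** Rounding the window up to whole periods at most doubles its length, which turns the factor 8
    into 4. *)
Lemma count_near_multiple_dense j N a : (n j.+1 <= N)%N ->
  (2 ^ j * (4 * count_window (near_multiple j) a N) <= N)%N.
Proof.
move=> nN.
have pj b : near_multiple j (b + (n j.+1)%:Z) = near_multiple j b.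
  by have := near_multipleD b 1 (ltnSn j); rewrite mul1r.
have := count_window_periodic_ub pj a N (n_gt0 j.+1).
set q := (N %/ n j.+1)%N => cq.
have q1 : (0 < q)%N by rewrite divn_gt0.
have qN : (q * n j.+1 <= N)%N by exact: leq_trunc_div.
have c2 : (2 ^ j * (8 * count_window (near_multiple j) 0 (n j.+1)) <= n j.+1)%N.
  apply: leq_trans (n_big j); rewrite !leq_mul2l count_near_multiple.
  by rewrite !orbT.
have : (q.+1 * (2 ^ j * (8 * count_window (near_multiple j) 0 (n j.+1))) <= 2 * N)%N.
  have : (q.+1 * n j.+1 <= 2 * N)%N by rewrite mulSn; nia.
  by apply: leq_trans; rewrite leq_mul2l c2 orbT.
have : (2 ^ j * (8 * count_window (near_multiple j) a N) <=
    2 ^ j * (8 * (q.+1 * count_window (near_multiple j) 0 (n j.+1))))%N.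
  by rewrite !leq_mul2l cq !orbT.
rewrite (mulnCA q.+1) (mulnCA q.+1); lia.
Qed.

Lemma toeplitz_example_weyl_periodic : weyl_periodic toeplitz_example.
Proof.
(* Levels [k] and [j] below take two windows of values of [P] each: four windows at [1 / (8 * e)]
   use half of the tolerance. The margins of levels from [K] on use the other half, as
   [2 * e = K <= 2 ^ K]. *)
move=> e; have [L0 sparse] := poly_range_sparse (e * 8)%N degP.
pose K := (e * 2)%N.
exists (fun b => `[< exists k, [/\ (k < K)%N, new_position k b & odd k] >]).
exists (n K), (maxn L0 (n K).+1); split=> // [b|N a].
  have pD k : (k < K)%N -> new_position k (b + (n K)%:Z) = new_position k b.
    by move=> /(new_positionD b 1); rewrite mul1r.
  by apply/asboolP/asboolP => -[k [kK pk ok]]; exists k; split=> //;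
    move: pk; rewrite pD.
rewrite geq_max => /andP[L0N nKN].
have exk : exists k, (N <= n k)%N by exists N; exact: period_ge.
(* The scale of the window is [n k < N <= n k.+1]; the case of index 0 contradicts [n K < N]. *)
have [[|k] Nk kmin] := ex_minnP exk.
  by have := leq_trans nKN (leq_trans Nk (period_le (leq0n K))); rewrite ltnn.
have nkN : (n k < N)%N by rewrite ltnNge; apply/negP => /kmin; rewrite ltnn.
have Kk : (K <= k)%N.
  by rewrite leqNgt; apply/negP => kK; have := leq_trans nKN (leq_trans Nk (period_le kK));
    rewrite ltnn.
have [j kj level] := new_position_one_level a Nk.
pose low (b : int) := has (fun i => near_multiple i b) (index_iota K k).
(* A difference needs a new position of level at least [K]: below [k] it lies in a margin, and above
   [k] only level [j] occurs in this window. *)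
have cover : (count_window (fun b => toeplitz_example b (+)
      `[< exists k, [/\ (k < K)%N, new_position k b & odd k] >]) a N <=
    count_window (fun b => low b || (new_position k b || new_position j b)) a N)%N.
  apply: count_window_le => b bw.
  have [[i Ki pib]|no] := pselect (exists2 i, (K <= i)%N & new_position i b).
    move=> _; case: (ltngtP i k) => [ik|ki|<-].
    - apply/orP; left; apply/hasP; exists i; first by rewrite mem_index_iota Ki.
      exact: new_position_near.
    - by rewrite (level b bw) ?orbT//; apply/asboolP; exists i.
    - by rewrite pib orbT.
  rewrite addbC; case: (boolP (toeplitz_example b)) => [/asboolP[i pib oi]|nx].
    case: asboolP => // -[]; exists i; split=> //.
    by rewrite ltnNge; apply/negP => Ki; apply: no; exists i.
  by case: asboolP => // -[i [_ pib oi]]; case/asboolP: nx; exists i.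
have lowc : (2 * (e * count_window low a N) <= N)%N.
  have c i : (K <= i < K + (k - K))%N ->
      (2 ^ i * (4 * count_window (near_multiple i) a N) <= N)%N.
    rewrite subnKC// => /andP[_ ik]; apply: count_near_multiple_dense.
    exact: leq_trans (period_le ik) (ltnW nkN).
  have := dyadic_sum_le c; rewrite subnKC// -big_distrr /=.
  have : (count_window low a N <= \sum_(K <= i < k) count_window (near_multiple i) a N)%N.
    rewrite /count_window exchange_big /=; apply: leq_sum => i _.
    rewrite /low; elim: (index_iota K k) => [|h s IHs]; first by rewrite big_nil.
    rewrite big_cons /=; case: (near_multiple h _) => //=.
  have := ltnW (ltn_expl K (ltnSn 1)); rewrite {1}/K; set q := (2 ^ K)%N.
  by move: (\sum_(K <= i < k) _)%N (count_window low a N) => S c'; nia.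
have n1j : (N <= n j.+1)%N.
  by apply: leq_trans Nk (period_le _); exact: leq_trans kj (leqnSn j).
have [a1 [a2 ck]] := new_position_sparse a Nk.
have [a3 [a4 cj]] := new_position_sparse a n1j.
have := sparse N a1 L0N; have := sparse N a2 L0N.
have := sparse N a3 L0N; have := sparse N a4 L0N.
have := count_window_orb low (fun b => new_position k b || new_position j b) a N.
have := count_window_orb (new_position k) (new_position j) a N.
by move: cover ck cj lowc; nia.
Qed.

End construction.

Lemma toeplitz_example_exists (P : {poly int}) :
  permutative P -> (1 < (size P).-1)%N ->
  exists (x : int -> bool) (n : nat -> nat),
    [/\ weyl_periodic x,
      forall r : nat, exists2 l : nat, surjective_mod P l &
        forall b (t : int), `|b| <= r%:Z -> x (b + t * l%:Z) = x b,
      forall k, (k <= n k)%N && (0 < n k)%N &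
      forall k, (4 * \sum_(1 <= m < (n k).+1) (x P.[m%:Z] != odd k) <= n k)%N].
Proof.
move=> Pperm degP; have [C [C1 Csurj Cnext]] := surjective_mod_chain Pperm.
(* The sum is a crude common bound for all [P m] with [m <= N]. *)
pose margin N := (\sum_(0 <= m < N.+1) `|P.[m%:Z]| + N)%N.
pose bound k N := (2 ^ k * (8 * (2 * margin N + 1)))%N.
have /choice[next nextP] (kN : nat * nat) : exists N' : nat,
    C kN.2 -> [/\ C N', (kN.2 %| N')%N & (bound kN.1 kN.2 <= N')%N].
  have [Cn|nC] := pselect (C kN.2); last by exists 0%N.
  by have [N' ?] := Cnext _ (bound kN.1 kN.2) Cn; exists N'.
pose n := fix n k := if k is k'.+1 then next (k', n k') else 1%N.
have nC k : C (n k) by elim: k => // k /(nextP (k, n k))[].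
have n_surj k : surjective_mod P (n k) by exact: Csurj.
have n_dvd k : (n k %| n k.+1)%N by have [] := nextP (k, n k) (nC k).
have n_big k : (2 ^ k * (8 * (2 * margin (n k) + 1)) <= n k.+1)%N.
  by have [] := nextP (k, n k) (nC k).
have E_big k m : (0 < m <= n k)%N -> (`|P.[m%:Z]| + n k <= margin (n k))%N.
  move=> /andP[_ mn]; rewrite leq_add2r big_mkord.
  by rewrite (bigD1 (Ordinal (mn : (m < (n k).+1)%N)))//= leq_addr.
exists (toeplitz_example P n (margin \o n)), n; split.
- exact: toeplitz_example_weyl_periodic.
- exact: toeplitz_example_window.
- move=> k; rewrite (n_surj k).1 andbT.
  exact: (@period_ge n (margin \o n)).
- exact: wrong_value_count.
Qed.

(** * Topology of the orbit closure *)

Definition agree (r : nat) (y z : int -> bool) : Prop :=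
  forall s : int, `|s| <= r%:Z -> y s = z s.

(** The sets containing a central cylinder around [y] form a filter, whose convergence to [y] is
    checked one coordinate at a time. *)
Lemma word_nbhs_agree (y : word) (U : set word) : nbhs y U ->
  exists r, forall z : word, agree r z y -> U z.
Proof.
pose F : set_system word :=
  [set A | exists r, forall z : word, agree r z y -> A z].
have FF : Filter F.
  split; first by exists 0%N.
  - move=> A B [r Ar] [r' Br']; exists (maxn r r') => z zy; split;
      [apply: Ar|apply: Br'] => s sr; apply: zy; apply: (le_trans sr);
      by rewrite lez_nat leq_max leqnn ?orbT.
  - by move=> A B AB [r Ar]; exists r => z /Ar /AB.
suff Fy : F --> y by move=> /Fy.
apply/cvg_sup => i A [B [[V oV <-] /= Vy] sBA].
exists `|i|%N => z zy; apply: sBA => /=; rewrite /proj /= zy//.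
Qed.

Lemma nbhs_agree (x : word) (y : toeplitz_system x) (U : set (toeplitz_system x)) :
  nbhs y U -> exists r, forall z, agree r (val z) (val y) -> U z.
Proof.
rewrite nbhsE => -[_ [[V oV <-] /= Vy] sU].
have [r rV] := word_nbhs_agree (open_nbhs_nbhs (conj oV Vy)).
by exists r => z zy; apply: sU; exact: rV.
Qed.

Lemma continuous_coordinate (x : word) (s : int) :
  continuous (fun y : toeplitz_system x => val y s).
Proof.
have cv : continuous (val : toeplitz_system x -> word).
  exact: (@initial_continuous (orbit_closure x) word set_val).
move=> y A As; apply: (cv y [set w : word | A (w s)]).
exact: (@proj_continuous _ (fun=> bool) s (val y) A As).
Qed.

Lemma clopen_coordinate (x : word) (s : int) (b : bool) :
  clopen [set y : toeplitz_system x | val y s = b].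
Proof.
apply: (@preimage_clopen _ _ (fun y : toeplitz_system x => val y s) [set b]).
  by split; [exact: discrete_open|exact: discrete_closed].
exact: continuous_coordinate.
Qed.

Lemma continuous_system_pow (x : word) (n : int) : continuous (@system_pow x n).
Proof.
move=> y U; rewrite nbhsE => -[_ [[V oV <-] /= Vy] sU].
have cv : continuous (val : toeplitz_system x -> word).
  exact: (@initial_continuous (orbit_closure x) word set_val).
have : nbhs y [set z : toeplitz_system x | V (sigma_pow n (val z))].
  exact: (cv y _ (continuous_sigma_pow (open_nbhs_nbhs (conj oV Vy)))).
by apply: filterS => z Vz; apply: sU.
Qed.

Lemma compact_toeplitz_system (x : word) : compact [set: toeplitz_system x].
Proof.
have cX : compact (orbit_closure x).
  apply: (subclosed_compact (@closed_closure _ _) _ (@subsetT _ _)).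
  have := @tychonoff int (fun=> bool) (fun=> setT) (fun=> bool_compact).
  by congr (compact _); apply/seteqP; split.
move=> F FF _.
have FX : ((val : toeplitz_system x -> word) @ F) (orbit_closure x).
  suff : F [set z | orbit_closure x (val z)] by [].
  by apply: filterE => z; exact: set_mem (valP z).
have [p [px clp]] := cX _ _ FX.
exists (exist _ p (mem_set px) : toeplitz_system x); split=> // A B FA.
rewrite nbhsE => -[_ [[V oV <-] /= Vp] VB].
have [|_ [[z Az <-] Vz]] := clp (val @` A) V _ (open_nbhs_nbhs (conj oV Vp)).
  suff : F [set z | (val @` A) (val z)] by [].
  by apply: filterS FA => z Az; exists z.
by exists z; split=> //; exact: VB.
Qed.

Lemma nbhs_sigma_pow (x : word) (y : toeplitz_system x) (U : set (toeplitz_system x)) :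
  nbhs y U -> exists i : int, U (system_pow i (toeplitz_point x)).
Proof.
rewrite nbhsE => -[_ [[V oV <-] /= Vy] sU].
have [_ [[i _ <-] Vi]] := set_mem (valP y) V (open_nbhs_nbhs (conj oV Vy)).
by exists i; apply: sU.
Qed.

(** The family [G] is left general to serve both the clopen sets and [visit_set]. *)
Lemma agree_setI_closed (x : word) (G : set (set (toeplitz_system x))) (w : word) :
  setI_closed G ->
  (forall (s : int) (b : bool), G [set y : toeplitz_system x | val y s = b]) ->
  forall r, G [set y : toeplitz_system x | agree r (val y) w].
Proof.
move=> GI Gcoord; elim=> [|r IHr].
  rewrite (_ : mkset _ = [set y : toeplitz_system x | val y 0 = w 0])//.
  by apply/seteqP; split=> y /= yw; [exact: yw|move=> s; rewrite normr_le0 => /eqP ->].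
rewrite (_ : mkset _ = [set y : toeplitz_system x | agree r (val y) w] `&`
   ([set y : toeplitz_system x | val y r.+1%:Z = w r.+1%:Z] `&`
    [set y : toeplitz_system x | val y (- r.+1%:Z) = w (- r.+1%:Z)])).
  by apply: (GI) => //; apply: GI.
apply/seteqP; split=> y /=.
  by move=> yw; split; [move=> s sr; apply: yw; lia|split; apply: yw; lia].
move=> [yw [yr yr']] s sr; have [sr'|sr'] := lerP `|s| r%:Z; first exact: yw.
by have [->|->] : s = r.+1%:Z \/ s = - r.+1%:Z by lia.
Qed.

Lemma clopen_agree (x : word) (w : word) (r : nat) :
  clopen [set y : toeplitz_system x | agree r (val y) w].
Proof.
by apply: agree_setI_closed => [|s b]; [exact: clopenI|exact: clopen_coordinate].
Qed.

Lemma orbit_agree (x : word) (y : toeplitz_system x) (r : nat) :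
  exists i : int, agree r (sigma_pow i x) (val y).
Proof.
have [oA _] := clopen_agree x (val y) r.
exact: (nbhs_sigma_pow (open_nbhs_nbhs (conj oA (fun _ _ => erefl)))).
Qed.

(** * Uniform densities *)

Section density.
Variable R : realType.
Implicit Type d : R.

Definition is_density f d : Prop := forall e : nat, exists N0, forall N a,
  (N0 <= N)%N -> `|(e * count_window f a N)%:R - (e * N)%:R * d| <= N%:R.

Lemma count_window_mul_le f (e N c q : nat) a :
  (forall b, (e * count_window f b N <= c)%N) ->
  (e * count_window f a (q * N) <= q * c)%N.
Proof.
move=> fc; elim: q a => [|q IHq] a; first by rewrite /count_window big_ord0 muln0.
by rewrite !mulSn count_windowD mulnDr leq_add.
Qed.

Lemma count_window_mul_ge f (e N c q : nat) a :
  (forall b, (c <= e * count_window f b N)%N) ->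
  (q * c <= e * count_window f a (q * N))%N.
Proof.
move=> fc; elim: q a => [|q IHq] a //.
by rewrite !mulSn count_windowD mulnDr leq_add.
Qed.

(* [d] is the supremum of the lower bounds [count / N - 1 / e]: by averaging
   over windows of length [N * N'], each is below every upper bound
   [count / N' + 1 / e']. *)
Lemma weyl_periodic_density f : weyl_periodic f -> exists d, is_density f d.
Proof.
move=> /weyl_periodic_uniform uni.
pose adm (e N : nat) := [/\ (0 < e)%N, (0 < N)%N & forall a b,
  (e * count_window f a N <= e * count_window f b N + N)%N].
pose lo (p : nat * nat) : R :=
  (count_window f 0 p.2)%:R / p.2%:R - p.1%:R^-1.
pose up (p : nat * nat) : R :=
  (count_window f 0 p.2)%:R / p.2%:R + p.1%:R^-1.
have loup p q : adm p.1 p.2 -> adm q.1 q.2 -> lo p <= up q.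
  case: p q => [e N] [e' N'] [/= e0 N0 h] [/= e0' N0' h'].
  have l1 : (N' * (e * count_window f 0 N - N) <= e * count_window f 0 (N' * N))%N.
    by apply: count_window_mul_ge => b; rewrite leq_subLR addnC.
  have u1 : (e' * count_window f 0 (N * N') <= N * (e' * count_window f 0 N' + N'))%N.
    by apply: count_window_mul_le.
  rewrite /lo /up /= -lerBlDr.
  move: l1 u1; rewrite (mulnC N N'); set c := count_window f 0 N.
  set c' := count_window f 0 N'; set C := count_window f 0 (N' * N).
  move=> l1 u1.
  have l2 : (N' * N)%:R * (c%:R / N%:R - e%:R^-1) <= C%:R :> R.
    have {}l1 : (N' * (e * c) <= e * C + N' * N)%N by nia.
    have NN : N%:R != 0 :> R by rewrite pnatr_eq0 -lt0n.
    have ee : e%:R != 0 :> R by rewrite pnatr_eq0 -lt0n.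
    rewrite -(@ler_pM2l _ e%:R) ?ltr0n//.
    rewrite (_ : _ * _ = (N' * (e * c))%:R - (N' * N)%:R); last first.
      by rewrite !natrM; field; rewrite NN ee.
    by rewrite lerBlDr -natrM -natrD ler_nat.
  have u2 : C%:R <= (N' * N)%:R * (c'%:R / N'%:R + e'%:R^-1) :> R.
    have NN : N'%:R != 0 :> R by rewrite pnatr_eq0 -lt0n.
    have ee : e'%:R != 0 :> R by rewrite pnatr_eq0 -lt0n.
    rewrite -(@ler_pM2l _ e'%:R) ?ltr0n//.
    rewrite [leRHS](_ : _ = (N * (e' * c' + N'))%:R); last first.
      by rewrite !natrM natrD natrM; field; rewrite NN ee.
    by rewrite -natrM ler_nat.
  have NN0 : 0 < (N' * N)%:R :> R by rewrite ltr0n muln_gt0 N0'.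
  by rewrite lerBlDr -(ler_pM2l NN0); exact: le_trans l2 u2.
have adm1 : adm 1%N 1%N.
  split=> // a b; rewrite !mul1n (leq_trans (count_window_size _ _ _))//.
  exact: leq_addl.
pose S : set R := [set lo p | p in [set p : nat * nat | adm p.1 p.2]].
have S0 : S !=set0 by exists (lo (1%N, 1%N)); exists (1%N, 1%N).
have Sub q : adm q.1 q.2 -> ubound S (up q).
  by move=> admq _ [p admp <-]; exact: loup.
exists (sup S) => e; have [->|e0] := posnP e.
  by exists 0%N => N a _; rewrite !mul0n mul0r subrr normr0.
(* Half of the tolerance moves the window from [0] to [a], half compares the frequency with the
   supremum. *)
have [N0 N0P] := uni (2 * e)%N; exists N0.+1 => N a N0N.
have admN : adm (2 * e)%N N.
  split; [by rewrite muln_gt0|exact: leq_trans N0N|].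
  by move=> b c; apply: N0P; exact: ltnW.
have le1 : lo (2 * e, N)%N <= sup S.
  apply: ub_le_sup; last by exists (2 * e, N)%N.
  by exists (up (1%N, 1%N)); exact: Sub.
have le2 : sup S <= up (2 * e, N)%N by apply: ge_sup => //; exact: Sub.
move: le1 le2; rewrite /lo /up /=; set s := sup S.
have NN : 0 < N%:R :> R by rewrite ltr0n; exact: leq_trans N0N.
have ee : 0 < e%:R :> R by rewrite ltr0n.
have [_ _ adN] := admN.
have := adN a 0; have := adN 0 a.
set c := count_window f 0 N; set ca := count_window f a N => ca1 ca2.
have {}ca1 : 2 * e%:R * c%:R <= 2 * e%:R * ca%:R + N%:R :> R.
  by rewrite -!natrM -natrD ler_nat.
have {}ca2 : 2 * e%:R * ca%:R <= 2 * e%:R * c%:R + N%:R :> R.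
  by rewrite -!natrM -natrD ler_nat.
have e2N : 0 < 2 * e%:R * N%:R :> R by rewrite !mulr_gt0.
rewrite -(ler_pM2l e2N) => le1; rewrite -(ler_pM2l e2N) => le2.
have E1 : 2 * e%:R * N%:R * (c%:R / N%:R - (2 * e)%:R^-1) = 2 * e%:R * c%:R - N%:R :> R.
  by rewrite natrM; field; rewrite (lt0r_neq0 ee) (lt0r_neq0 NN).
have E2 : 2 * e%:R * N%:R * (c%:R / N%:R + (2 * e)%:R^-1) = 2 * e%:R * c%:R + N%:R :> R.
  by rewrite natrM; field; rewrite (lt0r_neq0 ee) (lt0r_neq0 NN).
rewrite {}E1 in le1; rewrite {}E2 in le2.
by rewrite !natrM ler_norml; apply/andP; split; lra.
Qed.

Lemma archi_eq0 (z : R) (k : nat) : (forall e : nat, e%:R * `|z| <= k%:R) -> z = 0.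
Proof.
move=> h; apply/eqP; rewrite -normr_le0 leNgt; apply/negP => z0.
have := h (Num.bound (k%:R / `|z|)).
rewrite leNgt => /negP; apply; rewrite -ltr_pdivrMr//.
by apply: archi_boundP; rewrite divr_ge0.
Qed.

Lemma density_unique f d d' : is_density f d -> is_density f d' -> d = d'.
Proof.
move=> fd fd'; apply/eqP; rewrite -subr_eq0; apply/eqP; apply: (@archi_eq0 _ 2) => e.
have [N0 h] := fd e; have [N0' h'] := fd' e.
pose N := (maxn N0 N0').+1.
have {}h := h N 0 (leqW (leq_maxl _ _)); have {}h' := h' N 0 (leqW (leq_maxr _ _)).
have NN : 0 < N%:R :> R by rewrite ltr0n.
have := le_trans (ler_normB _ _) (lerD h' h).
rewrite opprB addrC addrA subrK -mulrBr natrM normrM normrM !normr_nat.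
rewrite -mulrA mulrCA (_ : N%:R + N%:R = N%:R * 2%:R); last by ring.
by rewrite ler_pM2l.
Qed.

Lemma density_cst (b : bool) : is_density (fun=> b) b%:R.
Proof.
move=> e; exists 0%N => N a _; rewrite /count_window sum_nat_const card_ord.
by rewrite mulnA natrM subrr normr0.
Qed.

Lemma density_ge0 f d : is_density f d -> 0 <= d.
Proof.
move=> fd; rewrite leNgt; apply/negP => d0.
suff d00 : d = 0 by move: d0; rewrite d00 ltxx.
apply: (@archi_eq0 _ 1) => e; have [N0 /(_ N0.+1 0 (leqnSn _))] := fd e.
rewrite ler_norml => /andP[_]; have NN : 0 < N0.+1%:R :> R by rewrite ltr0n.
rewrite (natrM _ e N0.+1) ltr0_norm// => h; rewrite -(ler_pM2l NN).
have : 0 <= (e * count_window f 0 N0.+1)%:R :> R by [].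
by lra.
Qed.

Lemma densityU f g d d' : (forall b, ~~ (f b && g b)) ->
  is_density f d -> is_density g d' -> is_density (fun b => f b || g b) (d + d').
Proof.
move=> dis fd gd e.
have [N0 h] := fd (2 * e)%N; have [N0' h'] := gd (2 * e)%N.
exists (maxn N0 N0') => N a; rewrite geq_max => /andP[/(h _ a) {}h /(h' _ a) {}h'].
have -> : count_window (fun b => f b || g b) a N =
    (count_window f a N + count_window g a N)%N.
  rewrite /count_window -big_split; apply: eq_bigr => i _ /=.
  by have := dis (a + i%:Z); case: (f _); case: (g _).
move: h h'; rewrite !ler_norml !natrM natrD => /andP[? ?] /andP[? ?].
by apply/andP; split; lra.
Qed.

Lemma density_shift f c d : is_density f d -> is_density (fun b => f (b + c)) d.
Proof.
move=> fd e; have [N0 h] := fd e; exists N0 => N a NN0.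
by rewrite count_window_shift; exact: h.
Qed.

End density.

(** * Unique ergodicity *)

Definition visits (x : word) (C : set (toeplitz_system x)) (i : int) : bool :=
  `[< C (system_pow i (toeplitz_point x)) >].

(* A copy of the system whose measurable sets are the clopen sets visited by
   the orbit of [x] along a Weyl-periodic set of times. *)
Definition visit_algebra (x : word) : Type := toeplitz_system x.

HB.instance Definition _ x := Pointed.on (visit_algebra x).

Definition visit_set (x : word) : set (set (visit_algebra x)) :=
  [set C : set (toeplitz_system x) | clopen C /\ weyl_periodic (visits C)].

Lemma visitsC (x : word) (C : set (toeplitz_system x)) i :
  visits (~` C) i = ~~ visits C i.
Proof. exact: asbool_neg. Qed.

Lemma visitsU (x : word) (C D : set (toeplitz_system x)) i :
  visits (C `|` D) i = visits C i || visits D i.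
Proof. exact: asbool_or. Qed.

Lemma visitsI (x : word) (C D : set (toeplitz_system x)) i :
  visits (C `&` D) i = visits C i && visits D i.
Proof. exact: asbool_and. Qed.

Lemma visit_set0 (x : word) : visit_set (set0 : set (visit_algebra x)).
Proof.
split; first exact: clopen0.
by apply: weyl_periodic_ext (weyl_periodic_cst false) => i; rewrite /visits asboolF.
Qed.

Lemma visit_setC (x : word) : setC_closed (@visit_set x).
Proof.
move=> C [cC wC]; split; first exact: clopenC.
by apply: weyl_periodic_ext (weyl_periodicN wC) => i; rewrite visitsC.
Qed.

Lemma visit_setU (x : word) : setU_closed (@visit_set x).
Proof.
move=> C D [cC wC] [cD wD]; split; first exact: clopenU.
by apply: weyl_periodic_ext (weyl_periodicU wC wD) => i; rewrite visitsU.
Qed.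

HB.instance Definition _ x := @isAlgebraOfSets.Build default_measure_display
  (visit_algebra x) (@visit_set x) (@visit_set0 x) (@visit_setU x) (@visit_setC x).

Lemma visit_setI (x : word) : setI_closed (@visit_set x).
Proof. by move=> C D mC mD; apply: (@measurableI _ (visit_algebra x)). Qed.

Section visit_measure.
Variables (R : realType) (x : word).
Notation X := (toeplitz_system x).

(** The default 0 concerns only sets without a density and keeps the function nonnegative there. *)
Definition visit_density (C : set (visit_algebra x)) : \bar R :=
  (xget 0 (@is_density R (visits (C : set X))))%:E.

Lemma visit_densityP (C : set X) d : is_density (visits C) d ->
  visit_density C = d%:E.
Proof.
by move=> Cd; rewrite /visit_density; congr EFin;
  apply: xget_unique => // d' /density_unique; exact.
Qed.

Lemma visit_density_ex (C : set X) : visit_set C -> exists d : R,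
  is_density (visits C) d.
Proof. by move=> [_ /weyl_periodic_density]; exact. Qed.

Lemma visit_density_ge0 C : (0 <= visit_density C)%E.
Proof.
by rewrite lee_fin; case: xgetP => // d _; exact: density_ge0.
Qed.

Lemma visit_density0 : visit_density set0 = 0%E.
Proof.
apply: visit_densityP => /=; rewrite (_ : visits _ = fun=> false).
  exact: (density_cst _ false).
by apply/funext => i; rewrite /visits asboolF.
Qed.

Lemma visit_densityT : visit_density setT = 1%E.
Proof.
apply: visit_densityP => /=; rewrite (_ : visits _ = fun=> true).
  exact: (density_cst _ true).
by apply/funext => i; rewrite /visits asboolT.
Qed.

Lemma visit_density_additive : measure_function.semi_additive visit_density.
Proof.
apply/(additive2P visit_density0) => C D mC mD CD.
have [d Cd] := visit_density_ex mC; have [d' Dd] := visit_density_ex mD.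
rewrite (visit_densityP Cd) (visit_densityP Dd) -EFinD; apply: visit_densityP.
rewrite (_ : visits _ = fun i => visits C i || visits D i).
  apply: densityU => // i; rewrite -visitsI CD /visits asboolF//.
by apply/funext => i; exact: visitsU.
Qed.

HB.instance Definition _ := isContent.Build _ (visit_algebra x) R visit_density
  visit_density_ge0 visit_density_additive.

(* By compactness a countable clopen partition of a clopen set is finite. *)
Lemma visit_density_sigma_additive : semi_sigma_additive visit_density.
Proof.
move=> F mF tF mUF.
have [n nF] : exists n, forall k, (n <= k)%N -> F k = set0.
  have cU : compact (\bigcup_n F n : set X).
    have [[_ clU] _] := (mUF : visit_set _).
    exact: (subclosed_compact clU (@compact_toeplitz_system x) (@subsetT _ _)).
  move: cU; rewrite (@compact_cover X) => /(_ nat setT (F : nat -> set X)).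
  case=> [i _|y|D _ sD]; first by have [[]] := (mF i : visit_set _).
    by [].
  (* Past the largest index of a finite subcover, a point of [F k] would also lie in some [F j] of
     the subcover, against disjointness. *)
  exists (\max_(i <- finmap.enum_fset D) i).+1 => k Dk; apply/seteqP; split=> // y Fky.
  have [j jD Fjy] := sD y (ex_intro2 _ _ k I Fky).
  have jk := tF j k I I (ex_intro _ y (conj Fjy Fky)).
  by move: Dk; rewrite -jk ltnNge (leq_bigmax_seq (F := id)).
have UE : \bigcup_i F i = \big[setU/set0]_(i < n) F i.
  rewrite -bigcup_mkord; apply/seteqP; split=> y [k]; last by exists k.
  move=> _ Fk; exists k => //=; rewrite ltnNge; apply/negP => nk.
  by move: Fk; rewrite nF.
rewrite UE measure_semi_additive//; last by rewrite -UE.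
apply: cvg_near_cst; exists n => // m /= nm.
rewrite -(big_mkord xpredT (fun i => visit_density (F i))) (big_cat_nat (leq0n n) nm) /=.
rewrite [X in (_ + X)%E]big_nat_cond [X in (_ + X)%E]big1 ?adde0// => k /andP[/andP[nk _] _].
by rewrite nF// visit_density0.
Qed.

HB.instance Definition _ := Content_isMeasure.Build _ (visit_algebra x) R visit_density
  visit_density_sigma_additive.

End visit_measure.

Lemma system_powD (x : word) (m n : int) (y : toeplitz_system x) :
  system_pow m (system_pow n y) = system_pow (m + n) y.
Proof. by apply: val_inj; rewrite /= sigma_powD. Qed.

Lemma visits_system_pow (x : word) (C : set (toeplitz_system x)) (n i : int) :
  visits (system_pow n @^-1` C) i = visits C (i + n).
Proof. by rewrite /visits /preimage /= system_powD addrC. Qed.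

Lemma visit_set_system_pow (x : word) (C : set (toeplitz_system x)) (n : int) :
  visit_set C -> visit_set (@system_pow x n @^-1` C).
Proof.
move=> [cC wC]; split; first exact: preimage_clopen cC (@continuous_system_pow x n).
by apply: weyl_periodic_ext (weyl_periodic_shift n wC) => i; rewrite visits_system_pow.
Qed.

Section unique_ergodicity.
Variables (R : realType) (x : word).
Hypothesis wx : weyl_periodic x.
Notation X := (toeplitz_system x).

Lemma visit_set_coordinate (s : int) (b : bool) :
  visit_set [set y : X | val y s = b].
Proof.
split; first exact: clopen_coordinate.
have := weyl_periodic_shift s wx; case: b => [|/weyl_periodicN];
  apply: weyl_periodic_ext => i; rewrite /visits /= /sigma_pow addrC;
  by case: (x _); apply/esym; [exact/asboolP|exact/asboolP].
Qed.

Lemma visit_set_agree (w : word) (r : nat) :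
  visit_set [set y : X | agree r (val y) w].
Proof.
apply: (@agree_setI_closed x (@visit_set x) _ _ visit_set_coordinate).
exact: visit_setI.
Qed.

(** The cylinders around orbit points of [x] form a countable base, so an open set is the countable
    union of those it contains. *)
Lemma open_visit_sets (U : set X) : open U -> <<s @visit_set x >> U.
Proof.
move=> oU.
pose cyl (p : int * nat) : set X :=
  [set y : X | agree p.2 (val y) (sigma_pow p.1 x)].
pose F (p : int * nat) : set (g_sigma_algebraType (@visit_set x)) :=
  if `[< cyl p `<=` U >] then cyl p else set0.
have -> : U = \bigcup_p F p.
  apply/seteqP; split=> [y Uy|y [p _]]; last first.
    by rewrite /F; case: asboolP => // pU; exact: pU.
  have [r rU] := nbhs_agree (open_nbhs_nbhs (conj oU Uy)).
  have [i iy] := orbit_agree y r; exists (i, r) => //.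
  rewrite /F; case: asboolP => [_|[]] /=.
    by move=> s sr; rewrite iy.
  by move=> z /= zi; apply: rU => s sr; rewrite zi// iy.
apply: (@countable_bigcupT_measurable _ (g_sigma_algebraType (@visit_set x)) _ F).
  exact: countableP.
move=> p; rewrite /F; case: ifP => _; last exact: measurable0.
by apply: sub_sigma_algebra; exact: visit_set_agree.
Qed.

Lemma borel_visit_sets : <<s @open X >> = <<s @visit_set x >>.
Proof.
apply/seteqP; split; apply: smallest_sub; try exact: smallest_sigma_algebra.
  exact: open_visit_sets.
by move=> C [[oC _] _]; exact: sub_sigma_algebra.
Qed.

Definition ergodic_measure : set (borel X) -> \bar R :=
  @measure_extension _ (visit_algebra x) R (@visit_density R x).

Lemma ergodic_measure_visit (C : set X) : visit_set C ->
  ergodic_measure C = visit_density R C.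
Proof. exact: (@measurable_mu_extE _ R (visit_algebra x) (@visit_density R x) C). Qed.

Lemma ergodic_measure0 : ergodic_measure set0 = 0%E.
Proof. by rewrite /ergodic_measure measure0. Qed.

Lemma ergodic_measure_ge0 A : (0 <= ergodic_measure A)%E.
Proof. by rewrite /ergodic_measure measure_ge0. Qed.

Lemma ergodic_measure_sigma_additive : semi_sigma_additive ergodic_measure.
Proof.
move=> F mF tF mUF.
have m A : measurable (A : set (borel X)) ->
    measurable (A : set (g_sigma_algebraType (@measurable _ (visit_algebra x)))).
  by rewrite /measurable /= borel_visit_sets.
apply: (@measure_semi_sigma_additive _ _ _
  (@measure_extension _ (visit_algebra x) R (@visit_density R x))) => //.
  by move=> i; exact: m.
exact: m.
Qed.

Lemma ergodic_measureT : ergodic_measure setT = 1%E.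
Proof.
rewrite ergodic_measure_visit ?visit_densityT//.
exact: (@measurableT _ (visit_algebra x)).
Qed.

Lemma ergodic_probability : exists mu : probability (borel X) R,
  forall C, visit_set C -> mu C = visit_density R C.
Proof.
pose mM := isMeasure.Build _ (borel X) R ergodic_measure ergodic_measure0
  ergodic_measure_ge0 ergodic_measure_sigma_additive.
pose mu : {measure set (borel X) -> \bar R} := HB.pack ergodic_measure mM.
pose pM := Measure_isProbability.Build _ (borel X) R mu ergodic_measureT.
pose mu' : probability (borel X) R := HB.pack (Measure.sort mu) pM.
by exists mu' => C; exact: ergodic_measure_visit.
Qed.

Lemma borel_measure_unique (mu nu : {measure set (borel X) -> \bar R}) :
  (mu setT < +oo)%E -> (forall C, visit_set C -> mu C = nu C) ->
  forall A, measurable A -> mu A = nu A.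
Proof.
move=> muT munu; apply: (@measure_unique _ R (borel X) (@visit_set x) (fun=> setT)) => //.
- exact: borel_visit_sets.
- exact: visit_setI.
- by move=> _; exact: (@measurableT _ (visit_algebra x)).
- by apply/seteqP; split=> // y _; exists 0%N.
Qed.

Lemma measurable_system_pow (n : int) :
  measurable_fun setT (@system_pow x n : borel X -> borel X).
Proof.
apply: (@measurability _ _ (borel X) (borel X) setT (@system_pow x n) (@open X)) => // _ [U oU <-].
rewrite setTI; apply: sub_sigma_algebra.
by move/continuousP : (@continuous_system_pow x n); exact.
Qed.

Lemma visit_density_system_pow (C : set X) (n : int) : visit_set C ->
  visit_density R (@system_pow x n @^-1` C) = visit_density R C.
Proof.
move=> mC; have [d Cd] := visit_density_ex R mC.
rewrite (visit_densityP Cd); apply: visit_densityP.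
rewrite (_ : visits _ = fun i => visits C (i + n)); first exact: density_shift.
by apply/funext => i; exact: visits_system_pow.
Qed.

(** The pushforward under the shift agrees with [mu] on [visit_set], since densities ignore shifts,
    and this pi-system determines a finite measure. *)
Lemma invariant_of_visit (mu : probability (borel X) R) :
  (forall C, visit_set C -> mu C = visit_density R C) ->
  invariant_measure (@system_pow x 1) mu.
Proof.
move=> muC A mA.
have mf := @measurable_system_pow 1.
pose nu : {measure set (borel X) -> \bar R} :=
  measure_function_pushforward__canonical__measure_function_Measure mu mf.
have := @borel_measure_unique nu mu _ _ A mA; apply.
- by rewrite /nu /= /pushforward preimage_setT probability_setT ltry.
- move=> C mC; rewrite /nu /= /pushforward !muC//; last exact: visit_set_system_pow.
  exact: visit_density_system_pow.
Qed.

End unique_ergodicity.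

(** The first [N] visits to a clopen set are locally constant in the point, and the orbit of [x] is
    dense. So uniform densities apply to every [y]. *)
Lemma orbit_visits (x : word) (C : set (toeplitz_system x)) (y : toeplitz_system x)
    (N : nat) : clopen C ->
  exists j : int, forall i : nat, (i < N)%N ->
    C (system_pow i%:Z y) <-> visits C (j + i%:Z).
Proof.
move=> cC.
have : nbhs y [set z | forall i : nat, (i < N)%N ->
    C (system_pow i%:Z z) <-> C (system_pow i%:Z y)].
  elim: N => [|N IHN]; first by apply: filterE.
  have [oN cN] := preimage_clopen cC (@continuous_system_pow x N%:Z).
  have yN : nbhs y [set z | C (system_pow N%:Z z) <-> C (system_pow N%:Z y)].
    have [Cy|nCy] := pselect (C (system_pow N%:Z y)).
      by apply: filterS (open_nbhs_nbhs (conj oN Cy)) => z Cz.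
    have ocN : open (~` (@system_pow x N%:Z @^-1` C)) by rewrite openC.
    by apply: filterS (open_nbhs_nbhs (conj ocN nCy)) => z nCz; split.
  apply: filterS (filterI IHN yN) => z [zi zN] i.
  by rewrite ltnS leq_eqVlt => /predU1P[->//|]; exact: zi.
move=> /nbhs_sigma_pow[j jP]; exists j => i iN.
have [h1 h2] := jP i iN; rewrite /visits -(addrC i%:Z) -system_powD.
by split=> [/h2 h|/asboolP/h1]; [exact/asboolP|].
Qed.

Section unique_invariant.
Variables (R : realType) (x : word).
Notation X := (toeplitz_system x).
Variable nu : probability (borel X) R.
Hypothesis nu_inv : invariant_measure (@system_pow x 1) nu.

Lemma clopen_measurable (C : set X) : clopen C -> measurable (C : set (borel X)).
Proof. by move=> [oC _]; exact: sub_sigma_algebra. Qed.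

Lemma invariant_measure_iter (C : set X) (i : nat) : clopen C ->
  nu (@system_pow x i%:Z @^-1` C) = nu C.
Proof.
move=> cC; elim: i => [|i IHi].
  by congr (nu _); apply/seteqP; split=> y /=;
    rewrite (_ : system_pow 0 y = y)//; apply: val_inj; exact: sigma_pow0.
rewrite -[RHS]IHi -(nu_inv (A := @system_pow x i%:Z @^-1` C)); last first.
  by apply: clopen_measurable; exact: preimage_clopen cC (@continuous_system_pow x i%:Z).
congr (nu _); apply/seteqP; split=> y /=; by rewrite system_powD -addn1 PoszD.
Qed.

(* Integrate the number of visits before time [N], which is close to [N * d]
   at every point. *)
Lemma invariant_measure_le (C : set X) : visit_set C ->
  (nu C <= visit_density R C)%E.
Proof.
move=> mC; have [d Cd] := visit_density_ex R mC.
rewrite (visit_densityP Cd); have [cC _] := mC.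
have nuC : nu C \is a fin_num by apply: fin_num_measure; exact: clopen_measurable.
rewrite -(fineK nuC) lee_fin; set v := fine (nu C).
suff ve (e : nat) : e%:R * (v - d) <= 1.
  rewrite -subr_le0 leNgt; apply/negP => vd.
  suff vd0 : v - d = 0 by move: vd; rewrite vd0 ltxx.
  by apply: (@archi_eq0 _ _ 1) => e; rewrite gtr0_norm.
have [N0 N0P] := Cd e; pose N := N0.+1.
have [->|e0] := posnP e; first by rewrite mul0r ler01.
have NN : 0 < N%:R :> R by rewrite ltr0n.
have ee : 0 < e%:R :> R by rewrite ltr0n.
pose Ci (i : nat) : set (borel X) := @system_pow x i%:Z @^-1` C.
have mCi i : measurable (Ci i).
  by apply: clopen_measurable; exact: preimage_clopen cC (@continuous_system_pow x i%:Z).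
have nuCi i : nu (Ci i) = nu C by exact: invariant_measure_iter.
have sumE : (\int[nu]_(y in setT) \sum_(0 <= i < N) (\1_(Ci i) y)%:E = (N%:R * v)%:E)%E.
  rewrite ge0_integral_sum//; last first.
    by move=> i; apply/measurable_EFinP; exact: measurable_indic.
  transitivity (\sum_(0 <= i < N) nu C)%E.
    by apply: eq_bigr => i _; rewrite integral_indic// setIT; exact: nuCi.
  by rewrite -(fineK nuC) sumEFin sumr_const_nat subn0 mulr_natl.
pose K : R := N%:R * d + N%:R / e%:R.
have sum_le y : (\sum_(0 <= i < N) (\1_(Ci i) y)%:E <= K%:E)%E.
  have [j jP] := orbit_visits y N cC.
  rewrite sumEFin lee_fin big_mkord.
  have -> : \sum_(i < N) \1_(Ci i) y = (count_window (visits C) j N)%:R :> R.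
    rewrite /count_window natr_sum; apply: eq_bigr => i _; rewrite indicE.
    congr (_ %:R); congr nat_of_bool; apply/idP/idP => [/set_mem /(jP i (ltn_ord i))//|].
    by move=> /(jP i (ltn_ord i)) h; apply/mem_set.
  have := N0P N j (leqnSn _); rewrite ler_norml => /andP[_].
  rewrite !natrM => h; rewrite /K -(ler_pM2l ee).
  have -> : e%:R * (N%:R * d + N%:R / e%:R) = e%:R * N%:R * d + N%:R :> R.
    by field; rewrite lt0r_neq0.
  by lra.
have : (\int[nu]_(y in setT) \sum_(0 <= i < N) (\1_(Ci i) y)%:E <=
        \int[nu]_(y in setT) K%:E)%E.
  apply: ge0_le_integral => //.
  - by move=> y _; apply: sume_ge0 => i _; rewrite lee_fin.
  - by apply: emeasurable_sum => i; apply/measurable_EFinP; exact: measurable_indic.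
have intK : (\int[nu]_(y in setT) K%:E = K%:E)%E.
  transitivity (K%:E * nu setT)%E; first exact: integral_cst.
  by rewrite probability_setT mule1.
rewrite sumE intK lee_fin => NvK.
rewrite -(ler_pM2l NN) mulrBr mulrBr mulr1.
move: NvK; rewrite /K -(ler_pM2l ee (N%:R * v)).
have -> : e%:R * (N%:R * d + N%:R / e%:R) = e%:R * N%:R * d + N%:R :> R.
  by field; rewrite lt0r_neq0.
lra.
Qed.

End unique_invariant.

Lemma weyl_periodic_uniquely_ergodic (R : realType) (x : word) :
  weyl_periodic x -> uniquely_ergodic (@system_pow x 1) R.
Proof.
move=> wx; have [mu muC] := ergodic_probability R wx.
exists mu; first exact: invariant_of_visit.
move=> nu nu_inv A mA.
have nu_mu (C : set (toeplitz_system x)) : visit_set C -> nu C = mu C.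
  move=> mC; apply/eqP; rewrite eq_le muC// invariant_measure_le//=.
  have mbC : measurable (C : set (borel (toeplitz_system x))).
    by apply: clopen_measurable; case: mC.
  (* The reverse inequality is the upper bound for the complement. *)
  have mC' := @visit_setC x C mC.
  have := invariant_measure_le nu_inv mC'; rewrite -muC// -(muC C)//.
  rewrite (probability_setC nu)// (probability_setC mu)//.
  have nuC : nu C \is a fin_num by exact: fin_num_measure.
  have muCfin : mu C \is a fin_num by exact: fin_num_measure.
  by rewrite -(fineK nuC) -(fineK muCfin) -!EFinB !lee_fin lerD2l lerN2.
apply: borel_measure_unique => //.
by apply: (le_lt_trans _ (ltry 1)); rewrite -(probability_setT nu).
Qed.

(** * Orbits along the polynomial *)

Section polynomial_orbits.
Variables (P : {poly int}) (x : word).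
Hypothesis x_window : forall r : nat, exists2 l : nat, surjective_mod P l &
  forall b (t : int), `|b| <= r%:Z -> x (b + t * l%:Z) = x b.

Lemma window_toeplitz : toeplitz_word x.
Proof.
move=> a; have [l [l0 _] lP] := x_window `|a|%N.
by exists l%:Z => [|j]; [lia|rewrite lP].
Qed.

Lemma polynomial_orbit_dense (y : toeplitz_system x) :
  dense [set system_pow P.[n%:Z] y | n in [set n : nat | (1 <= n)%N]].
Proof.
move=> U [z Uz] oU.
have [i Ui] := nbhs_sigma_pow (open_nbhs_nbhs (conj oU Uz)).
have [r rU] := nbhs_agree (open_nbhs_nbhs (conj oU Ui)).
have [l sl lP] := x_window (`|i| + r)%N.
(* [m] depends on [j], so the radius is chosen beforehand to cover every [P m] with [m <= l]. *)
have [j jy] := orbit_agree y (\sum_(m < l.+1) `|P.[m%:Z]| + r)%N.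
have [m /andP[m0 ml] /dvdzP[t tE]] := surjective_mod_nat (i - j) sl.
exists (system_pow P.[m%:Z] y); split; last by exists m.
have Pm : (`|P.[m%:Z]| <= \sum_(m < l.+1) `|P.[m%:Z]|)%N.
  by rewrite (bigD1 (Ordinal (ml : (m < l.+1)%N)))//= leq_addr.
apply: rU => s sr /=; rewrite /sigma_pow -jy /sigma_pow; last by lia.
have -> : s + P.[m%:Z] + j = s + i + t * l%:Z by lia.
by apply: lP; lia.
Qed.

(** [F] contains the two-sided orbit of [y], hence its dense part along [P]; the backward half
    covers negative values of [P]. *)
Lemma polynomial_orbit_minimal : minimal (@system_pow x 1).
Proof.
move=> F cF [y Fy] FE.
have Fpos (n : nat) : F (system_pow n%:Z y).
  elim: n => [|n IHn].
    by rewrite (_ : system_pow 0 y = y)//; apply: val_inj; exact: sigma_pow0.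
  by rewrite -add1n PoszD -system_powD -FE; exists (system_pow n%:Z y).
have Fneg (n : nat) : F (system_pow (- n%:Z) y).
  elim: n => [|n IHn]; first exact: (Fpos 0%N).
  move: IHn; rewrite -{1}FE => -[z Fz zE].
  suff -> : system_pow (- n.+1%:Z) y = z by [].
  have -> : - n.+1%:Z = -1 + - n%:Z by lia.
  rewrite -system_powD -zE system_powD addNr.
  by apply: val_inj; exact: sigma_pow0.
apply/seteqP; split=> // z _; apply: contrapT => nFz.
have oF : open (~` F) by rewrite openC.
have [w [nF [n _ nE]]] := @polynomial_orbit_dense y _ (ex_intro _ z nFz) oF.
apply: nF; rewrite -nE; case: (P.[n%:Z]) => k //.
by rewrite NegzE.
Qed.

End polynomial_orbits.

(** * Divergence of the averages *)

Lemma alternating_average_diverges (K : numFieldType) (u : nat -> bool) (n : nat -> nat) :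
  (forall k, (k <= n k)%N && (0 < n k)%N) ->
  (forall k, (4 * \sum_(1 <= m < (n k).+1) (u m != odd k) <= n k)%N) ->
  ~ cvg ((fun N : nat => N%:R^-1 * \sum_(1 <= m < N.+1) (-1) ^+ u m : K) @ \oo).
Proof.
move=> nk wrong /cvg_ex[l] /cvgrPdist_lt /(_ 2^-1 _)[|N0 _ aP].
  by rewrite invr_gt0 ltr0n.
pose a N : K := N%:R^-1 * \sum_(1 <= m < N.+1) (-1) ^+ u m.
have close N : (N0 <= N)%N -> `|l - a N| < 2^-1 by exact: aP.
have aE k : 2^-1 <= (-1) ^+ odd k * a (n k).
  have [_ n0] := andP (nk k); have nn : 0 < (n k)%:R :> K by rewrite ltr0n.
  set w := (\sum_(1 <= m < (n k).+1) (u m != odd k))%N.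
  have -> : (-1) ^+ odd k * a (n k) = (n k)%:R^-1 * ((n k)%:R - 2 * w%:R).
    rewrite /a mulrCA; congr (_ * _).
    rewrite /w natr_sum !mulr_sumr.
    have -> : (n k)%:R = \sum_(1 <= m < (n k).+1) 1 :> K.
      by rewrite sumr_const_nat subSS subn0.
    rewrite -sumrB; apply: eq_bigr => m _; rewrite -signr_addb.
    by case: (u m); case: (odd k); rewrite /= ?expr0 ?expr1; ring.
  rewrite mulrC ler_pdivlMr//.
  have : (4 * w)%:R <= (n k)%:R :> K by rewrite ler_nat; exact: wrong.
  rewrite natrM => w4; rewrite -subr_ge0.
  rewrite (_ : _ - _ = 2^-1 * ((n k)%:R - 4%:R * w%:R)); last by field.
  by rewrite mulr_ge0 ?invr_ge0 ?ler0n// subr_ge0.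
(* As [k <= n k], both times lie past [N0], and consecutive levels have opposite signs: averages at
   distance at least 1 would be less than [1/2] from the limit. *)
have [kN0 _] := andP (nk N0); have [kN1 _] := andP (nk N0.+1).
have d0 := close _ kN0; have d1 := close _ (ltnW kN1 : (N0 <= n N0.+1)%N).
have := lerD (aE N0) (aE N0.+1).
rewrite /= signrN mulNr -mulrBr => ge1.
have : `|a (n N0) - a (n N0.+1)| < 1.
  rewrite (_ : a (n N0) - a (n N0.+1) = (l - a (n N0.+1)) - (l - a (n N0))); last by ring.
  apply: le_lt_trans (ler_normB _ _) _.
  by rewrite [ltRHS](splitr 1) mul1r ltrD.
rewrite -(normrMsign (odd N0)) => lt1.
have : 1 < 1 :> K; last by rewrite ltxx.
apply: le_lt_trans lt1; rewrite [leLHS](splitr 1) mul1r (le_trans ge1)//.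
(* The order of [K] may be partial; [ge1] is what makes this number real and nonnegative. *)
by rewrite ger0_norm// (le_trans _ ge1)// addr_ge0// invr_ge0 ler0n.
Qed.

Theorem theorem5p8 (R : realType) (P : {poly int})
    (Pperm : permutative P) (degP : (1 < (size P).-1)%N) :
  exists x : word,
    [/\ toeplitz_word x,
        strictly_ergodic (@system_pow x 1) R,
        forall y : toeplitz_system x,
          dense [set system_pow P.[n%:Z] y | n in [set n : nat | (1 <= n)%N]],
        continuous (@sign_at0 R x) &
        ~ cvg ((fun N : nat => N%:R^-1 *
            \sum_(1 <= m < N.+1)
              sign_at0 R (system_pow P.[m%:Z] (toeplitz_point x))) @ \oo)].
Proof.
have [x [n [wx x_window nk wrong]]] := toeplitz_example_exists Pperm degP.
exists x; split.
- exact: window_toeplitz x_window.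
- split; first exact: polynomial_orbit_minimal x_window.
  exact: weyl_periodic_uniquely_ergodic.
- exact: polynomial_orbit_dense x_window.
- exact: continuous_sign_at0.
- have -> : (fun N : nat => N%:R^-1 * \sum_(1 <= m < N.+1)
        sign_at0 R (system_pow P.[m%:Z] (toeplitz_point x))) =
      (fun N : nat => N%:R^-1 * \sum_(1 <= m < N.+1) (-1) ^+ x P.[m%:Z]).
    apply/funext => N; congr (_ * _); apply: eq_bigr => m _.
    by rewrite /sign_at0 /= /sigma_pow add0r.
  exact: alternating_average_diverges nk wrong.
Qed.
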